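(* Let $\Omega\subset\mathbb{R}^3$, let $(\lambda,u)$ be an eigenpair (with $u\ne0$) of $$(\nabla^2 u,\nabla^2 v)_{L^2(\Omega)}=\lambda(u,v)_{L^2(\Omega)}\quad\text{for any } v\in H_0^2(\Omega),$$ and assume $u\in H_0^2(\Omega)\cap H^4(\Omega)$. Let $$J_1:=\sum_{i=1}^3\int_\Omega\left(\frac{\partial^2(u-\Pi_hu)}{\partial x_i^2}\right)^2dx_1dx_2dx_3,$$ where the derivatives of $\Pi_h u$ are taken element by element. Then there is a constant $\beta>0$, independent of $h$, such that $$\beta h^2\le J_1.$$
   Context: $\nabla^2 w$ is the Hessian matrix of $w$. $\mathcal{T}_h$ is a regular uniform rectangular triangulation of $\Omega\subset\mathbb{R}^3$ with meshsize $h$: with $(x_{1,c},x_{2,c},x_{3,c})$ the center of $K\in\mathcal{T}_h$, the map $\xi_i=(x_i-x_{i,c})/h$, $i=1,2,3$, sends $K$ onto $[-1,1]^3$ (so $K$ is a cube of side $2h$). On $K$ let $P_T(K)=P_2(K)+\mathrm{span}\{x_1^3,x_2^3,x_3^3,x_1x_2x_3\}$, where $P_2(K)$ denotes the polynomials of degree $\le2$ on $K$. The interpolation operator $\Pi_K:H^3(K)\to P_T(K)$ is defined by $(\Pi_Kv)(P)=v(P)$ for each of the 8 vertices $P$ of $K$ and $\int_F\frac{\partial\Pi_Kv}{\partial\nu_F}\,ds=\int_F\frac{\partial v}{\partial\nu_F}\,ds$ for each of the 6 faces $F$ of $K$ ($\nu_F$ a unit normal to $F$). The global operator $\Pi_h$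 is defined by $(\Pi_hu)|_K=\Pi_K(u|_K)$ for all $K\in\mathcal{T}_h$. *)

(* Defs.v *)
From HB Require Import structures.
From mathcomp Require Export all_boot all_order all_algebra.
From mathcomp Require Export all_classical all_reals all_analysis.

Set Implicit Arguments.
Unset Strict Implicit.
Unset Printing Implicit Defensive.

Export Order.TTheory GRing.Theory Num.Theory numFieldNormedType.Exports.

Local Open Scope classical_set_scope.
Local Open Scope ring_scope.

(* [measurableTypeR R] is [R] with its Borel sigma-algebra and its usual
   normed-space structure. *)
Notation R2 R := (measurableTypeR R * measurableTypeR R)%type.
Notation R3 R := (measurableTypeR R * measurableTypeR R * measurableTypeR R)%type.

Section Definitions.
Context {R : realType}.

Definition mu2 : {measure set (R2 R) -> \bar R} :=
  (@lebesgue_measure R \x @lebesgue_measure R)%E.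

Definition mu3 : {measure set (R3 R) -> \bar R} :=
  ((@lebesgue_measure R \x @lebesgue_measure R) \x @lebesgue_measure R)%E.

Definition coord (i : 'I_3) (x : R3 R) : R := nth 0 [:: x.1.1; x.1.2; x.2] i.

Definition basis_vec (i : 'I_3) : R3 R :=
  ((i == 0%N :> nat)%:R, (i == 1%N :> nat)%:R, (i == 2%N :> nat)%:R).

(* Multi-indices are lists of directions: [pderiv [:: i; j] f] is the iterated
   classical partial derivative of [f] in the directions j, then i. *)
Definition pderiv (s : seq 'I_3) (f : R3 R -> R) : R3 R -> R :=
  foldr (fun i g x => 'D_(basis_vec i) g x) f s.

Definition smooth (f : R3 R -> R) : Prop :=
  forall s x, differentiable (pderiv s f) x.

(* phi \in C_c^oo(O) *)
Definition test_fun (O : set (R3 R)) (phi : R3 R -> R) : Prop :=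
  smooth phi /\
  exists K, [/\ compact K, K `<=` O & forall x, ~ K x -> phi x = 0].

Definition loc_integrable (O : set (R3 R)) (f : R3 R -> R) : Prop :=
  measurable_fun O f /\
  forall K, compact K -> K `<=` O -> mu3.-integrable K (EFin \o f).

Definition is_weak_deriv (O : set (R3 R)) (s : seq 'I_3) (f g : R3 R -> R) :=
  [/\ loc_integrable O f, loc_integrable O g &
      forall phi, test_fun O phi ->
        \int[mu3]_(x in O) (f x * pderiv s phi x) =
        (-1) ^+ size s * \int[mu3]_(x in O) (g x * phi x)].

(* The weak derivative, unique up to equality a.e. in O; it is the zero
   function if [f] has no weak derivative. *)
Definition weak_deriv (O : set (R3 R)) (s : seq 'I_3) (f : R3 R -> R) :
    R3 R -> R :=
  xget (fun=> 0) [set g | is_weak_deriv O s f g].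

Definition L2 (O : set (R3 R)) (f : R3 R -> R) : Prop :=
  measurable_fun O f /\ mu3.-integrable O (fun x => (f x ^+ 2)%:E).

Definition sobolev (k : nat) (O : set (R3 R)) (f : R3 R -> R) : Prop :=
  L2 O f /\
  forall s, (size s <= k)%N -> exists2 g, L2 O g & is_weak_deriv O s f g.

(* H_0^k(O), the closure of C_c^oo(O) in H^k(O) *)
Definition sobolev0 (k : nat) (O : set (R3 R)) (f : R3 R -> R) : Prop :=
  sobolev k O f /\
  forall eps : R, 0 < eps -> exists2 phi, test_fun O phi &
    forall s, (size s <= k)%N ->
      (\int[mu3]_(x in O) ((weak_deriv O s f x - pderiv s phi x) ^+ 2)%:E
         < eps%:E)%E.

(* (lam, u) is an eigenpair of
   (hess u, hess v)_{L^2(O)} = lam (u, v)_{L^2(O)} on H_0^2(O) *)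
Definition eigenpair (O : set (R3 R)) (lam : R) (u : R3 R -> R) : Prop :=
  [/\ sobolev0 2 O u,
      ~ {ae mu3, forall x, O x -> u x = 0} &
      forall v, sobolev0 2 O v ->
        \sum_(i < 3) \sum_(j < 3)
          \int[mu3]_(x in O)
            (weak_deriv O [:: i; j] u x * weak_deriv O [:: i; j] v x) =
        lam * \int[mu3]_(x in O) (u x * v x)].

(* Elements are cubes of side 2h, represented by their centre c. *)
Definition cube (h : R) (c : R3 R) : set (R3 R) :=
  [set x | forall i, `|coord i x - coord i c| <= h].

Definition open_cube (h : R) (c : R3 R) : set (R3 R) :=
  [set x | forall i, `|coord i x - coord i c| < h].

(* The closed faces of [cube h c] of all dimensions: coordinate i is fixed to
   c_i + h or c_i - h when [t i] is [Some false] or [Some true], and is free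
   when [t i] is [None]. *)
Definition subface (h : R) (c : R3 R) (t : 'I_3 -> option bool) : set (R3 R) :=
  [set x | forall i, if t i is Some b then coord i x = coord i c + (-1) ^+ b * h
                     else `|coord i x - coord i c| <= h].

Definition triangulation (O : set (R3 R)) (h : R) (T : seq (R3 R)) : Prop :=
  [/\ 0 < h /\ uniq T,
      closure O = [set x | exists2 c, c \in T & cube h c x],
      forall c, c \in T -> open_cube h c `<=` O,
      forall c d, c \in T -> d \in T -> c <> d ->
        open_cube h c `&` open_cube h d = set0 &
      forall c d, c \in T -> d \in T -> c <> d ->
        cube h c `&` cube h d = set0 \/
        exists t t', cube h c `&` cube h d = subface h c t /\
                     cube h c `&` cube h d = subface h d t'].

(* P_T(K) = P_2(K) + span {x_1^3, x_2^3, x_3^3, x_1 x_2 x_3} *)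
Definition PT (p : R3 R -> R) : Prop :=
  exists (a : R) (b : 'I_3 -> R) (q : 'I_3 -> 'I_3 -> R) (g : 'I_3 -> R) (d : R),
    forall x, p x =
      a + \sum_(i < 3) b i * coord i x
      + \sum_(i < 3) \sum_(j < 3) q i j * coord i x * coord j x
      + \sum_(i < 3) g i * coord i x ^+ 3
      + d * \prod_(i < 3) coord i x.

(* Point of the plane x_i = a whose other two coordinates are y. *)
Definition plane_pt (i : 'I_3) (a : R) (y : R2 R) : R3 R :=
  if i == 0%N :> nat then (a, y.1, y.2)
  else if i == 1%N :> nat then (y.1, a, y.2) else (y.1, y.2, a).

(* Surface integral of f over the face x_i = c_i + (-1)^b h of [cube h c]. *)
Definition face_int (h : R) (c : R3 R) (i : 'I_3) (b : bool) (f : R3 R -> R) : R :=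
  let a := coord i c + (-1) ^+ b * h in
  \int[mu2]_(y in [set y | cube h c (plane_pt i a y)]) f (plane_pt i a y).

(* w is a representative of v in C^1(K), K = [cube h c], with partial
   derivatives dw continuous up to the boundary.  As H^3(K) embeds in C^1(K)
   in dimension three, it exists for v in H^3(K); it is unique on K, and it
   gives the meaning of v(P) and of the trace of the normal derivative. *)
Definition C1_repr (h : R) (c : R3 R) (v w : R3 R -> R)
    (dw : 'I_3 -> R3 R -> R) : Prop :=
  [/\ {ae mu3, forall x, cube h c x -> w x = v x},
      {within cube h c, continuous w},
      forall i, {within cube h c, continuous (dw i)} &
      forall i x, open_cube h c x -> is_derive x (basis_vec i) w (dw i x)].

(* p satisfies the conditions that define Pi_K v.  The unit normal of the faces
   orthogonal to the i-th axis is [basis_vec i]. *)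
Definition is_interpolant (h : R) (c : R3 R) (v p : R3 R -> R) : Prop :=
  PT p /\
  exists w dw, [/\ C1_repr h c v w dw,
    forall x, (forall i, `|coord i x - coord i c| = h) -> p x = w x &
    forall i b, face_int h c i b (fun x => 'D_(basis_vec i) p x) =
                face_int h c i b (dw i)].

(* The interpolant exists and is unique for v in H^3(K); the default value is
   only reached outside of this space. *)
Definition Pi_K (h : R) (c : R3 R) (v : R3 R -> R) : R3 R -> R :=
  xget (fun=> 0) [set p | is_interpolant h c v p].

(* The function equal to [F c] in the interior of the element of centre c, and
   to 0 on the (negligible) skeleton of the mesh. *)
Definition piecewise (h : R) (T : seq (R3 R)) (F : R3 R -> R3 R -> R) : R3 R -> R :=
  fun x => \sum_(c <- T) \1_(open_cube h c) x * F c x.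

Definition Pi_h (h : R) (T : seq (R3 R)) (v : R3 R -> R) : R3 R -> R :=
  piecewise h T (fun c => Pi_K h c v).

Definition broken_deriv (h : R) (T : seq (R3 R)) (s : seq 'I_3) (f : R3 R -> R) :
    R3 R -> R :=
  piecewise h T (fun=> pderiv s f).

Definition J1 (O : set (R3 R)) (h : R) (T : seq (R3 R)) (u : R3 R -> R) : \bar R :=
  (\sum_(i < 3) \int[mu3]_(x in O)
     ((weak_deriv O [:: i; i] u x
       - broken_deriv h T [:: i; i] (Pi_h h T u) x) ^+ 2)%:E)%E.

End Definitions.

(* Main.v *)
From HB Require Import structures.
Require Import Defs.
From mathcomp Require Import measurable_realfun ring lra.

Set Implicit Arguments.
Unset Strict Implicit.
Unset Printing Implicit Defensive.

Local Open Scope classical_set_scope.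
Local Open Scope ring_scope.

(** Why the bound holds.  For p in P_T(K) the second derivative of p in the
    direction i is affine in x_i alone: it does not see the other variables.
    So J_1 measures how badly f = d_i d_i u is approximated, element by
    element, by functions that are constant in a direction j different from i,
    and this error cannot be o(h) unless G = d_j f vanishes.

    To turn this into an estimate for every mesh, fix a test function psi such
    that gam = int G psi is not 0, and multiply it by S, a sum of smooth bumps
    supported in the open elements.  As psi S vanishes near the boundary of
    every element, d_j (psi S) is orthogonal on each element to the functions
    that depend on x_i only (broken_cutoff_flux), hence
      int (f - d_i d_i Pi_h u) d_j (psi S) = - int G psi S.
    Each bump is t-close to 1 outside a boundary layer of relative width t, so
    1 - S has L^2 norm O(sqrt t) whatever h is (cutoff_deficit_le), and some t
    that depends on G and psi only makes the right-hand side at least |gam|/2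
    in absolute value.  On the other side |d_j (psi S)| <= C / h
    (pderiv_cutoff_le), and Cauchy-Schwarz gives
      gam^2 / 4 <= J_1 * (C / h)^2 * |Omega|.

    A suitable psi exists because u is not 0 (nondegenerate).  Otherwise
    int f d_j psi = 0 for all psi.  Take psi = x_j phi with phi a test function
    close to u in H^2: the identity
      int d_i d_i phi d_j (x_j phi) = - 1/2 int (d_i phi)^2
    (mixed_identity) shows that d_i phi tends to 0 in L^2, so does phi by
    Poincare's inequality, and u = 0 almost everywhere by the du Bois-Reymond
    lemma. *)

(** * Calculus of smooth functions of three variables *)

Section Calculus.
Context {R : realType}.
Implicit Types (f g : R3 R -> R) (i j : 'I_3) (x v : R3 R).

Lemma pderiv_cat s t f : pderiv (s ++ t) f = pderiv s (pderiv t f).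
Proof. by rewrite /pderiv foldr_cat. Qed.

Lemma smooth_pderiv s f : smooth f -> smooth (pderiv s f).
Proof. by move=> sf t x; rewrite -pderiv_cat; exact: sf. Qed.

Lemma smooth_differentiable f : smooth f -> forall x, differentiable f x.
Proof. by move=> sf; exact: (sf [::]). Qed.

Lemma smooth_continuous f : smooth f -> continuous f.
Proof.
by move=> sf x; exact/differentiable_continuous/smooth_differentiable.
Qed.

Lemma smooth_derivable f : smooth f -> forall x v, derivable f x v.
Proof. by move=> sf x v; exact/diff_derivable/smooth_differentiable. Qed.

(** Differentiability up to a finite order: the Leibniz rule is proved by
    induction on the order, and turns a product into a sum of products that are
    only known to be smooth up to the previous order. *)
Definition smooth_upto n f :=
  forall s x, (size s <= n)%N -> differentiable (pderiv s f) x.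

Lemma pderivD_upto s f g : smooth_upto (size s) f -> smooth_upto (size s) g ->
  pderiv s (f + g) = pderiv s f + pderiv s g.
Proof.
elim: s => //= i s IH sf sg.
rewrite IH; last 2 first.
- by move=> t x /leqW; exact: sf.
- by move=> t x /leqW; exact: sg.
apply/funext => x; rewrite deriveD//; apply/diff_derivable.
- exact: sf.
- exact: sg.
Qed.

Lemma smooth_uptoD n f g :
  smooth_upto n f -> smooth_upto n g -> smooth_upto n (f + g).
Proof.
move=> sf sg s x sn; have hu k (hk : smooth_upto n k) : smooth_upto (size s) k.
  by move=> t y ts; apply: hk; exact: leq_trans sn.
rewrite pderivD_upto; [|exact: hu..].
by apply: differentiableD; [exact: sf|exact: sg].
Qed.

Lemma pderivD s f g : smooth f -> smooth g ->
  pderiv s (f + g) = pderiv s f + pderiv s g.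
Proof. by move=> sf sg; apply: pderivD_upto => t x _; [exact: sf|exact: sg]. Qed.

Lemma smoothD f g : smooth f -> smooth g -> smooth (f + g).
Proof.
by move=> sf sg s x; rewrite pderivD//; exact/differentiableD.
Qed.

Lemma pderivM i f g : smooth f -> smooth g ->
  pderiv [:: i] (f * g) = pderiv [:: i] f * g + f * pderiv [:: i] g.
Proof.
move=> sf sg; apply/funext => x /=.
rewrite deriveM//; [|exact: smooth_derivable..].
by rewrite addrC [X in X + _ = _]mulrC.
Qed.

Lemma smoothM f g : smooth f -> smooth g -> smooth (f * g).
Proof.
suff H n : forall f g, smooth f -> smooth g -> smooth_upto n (f * g).
  by move=> sf sg s x; exact: (H (size s)).
elim: n => [|n IH] {}f {}g sf sg s x.
  by rewrite leqn0 size_eq0 => /eqP ->;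
    apply: differentiableM; exact: smooth_differentiable.
case/lastP: s => [_|s i].
  by apply: differentiableM; exact: smooth_differentiable.
rewrite size_rcons ltnS -cats1 pderiv_cat pderivM// => sn.
by apply: (smooth_uptoD (n := n)) => //; apply: IH => //; exact: smooth_pderiv.
Qed.

Lemma coord_continuous i : continuous (@coord R i).
Proof.
case: i => [[|[|[|//]]] ?]; rewrite /coord /= => x.
- by apply: (@cvg_comp _ _ _ (fun x : R3 R => x.1) fst);
    [exact: cvg_fst|exact: cvg_fst].
- by apply: (@cvg_comp _ _ _ (fun x : R3 R => x.1) snd);
    [exact: cvg_fst|exact: cvg_snd].
- exact: cvg_snd.
Qed.

Lemma coord_linear i : linear (@coord R i).
Proof. by case: i => [[|[|[|//]]] ?] a x y. Qed.

HB.instance Definition _ i :=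
  GRing.isLinear.Build R (R3 R) R _ (@coord R i) (coord_linear i).

Lemma coord_basis i j : coord i (basis_vec j) = (i == j)%:R :> R.
Proof.
by case: i => [[|[|[|//]]] ?]; case: j => [[|[|[|//]]] ?].
Qed.

Lemma coord_line i j x t :
  coord i (x + t *: basis_vec j) = coord i x + t * (i == j)%:R.
Proof. by rewrite linearD linearZ /= coord_basis. Qed.

(** A function given with all its derivatives.  Composing such a tower with an
    affine function of one coordinate yields smooth functions on the space: the
    affine functions of a coordinate and the factors of the bumps arise so. *)
Definition derivation_tower (g : nat -> R -> R) :=
  forall n (t : R), is_derive t 1 (g n) (g n.+1 t).

Lemma pderiv_tower (g : nat -> R -> R) : derivation_tower g ->
  forall n k a b i j, pderiv [:: j] (fun x => k * g n (a * coord i x + b)) =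
    fun x => k * (i == j)%:R * a * g n.+1 (a * coord i x + b).
Proof.
move=> hg n k a b i j; apply/funext => x /=.
rewrite [LHS]/derive.
have -> : (fun h => h^-1 *: (((fun x0 => k * g n (a * coord i x0 + b)) \o shift x)
            (h *: basis_vec j) - k * g n (a * coord i x + b))) =
    (fun h => h^-1 *: (((fun t => k * g n (a * (coord i x + t * (i == j)%:R) + b)) \o shift 0)
            (h *: 1) - k * g n (a * (coord i x + 0 * (i == j)%:R) + b))).
  apply/funext => h /=; rewrite (addrC (h *: _)) coord_line mul0r !addr0.
  by rewrite /GRing.scale /= mulr1.
rewrite -/(derive _ _ _).
pose l := fun t : R => a * (coord i x + t * (i == j)%:R) + b.
have dl : is_derive (0 : R) 1 l (a * (i == j)%:R).
  have -> : l = cst (a * coord i x + b) + (a * (i == j)%:R) \*: id.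
    by apply/funext => t; rewrite /l !fctE /= -[_ *: t]/(_ * t); ring.
  apply: is_derive_eq; rewrite add0r; exact: mulr1.
have dg : is_derive (l 0) 1 (g n) (g n.+1 (l 0)) by exact: hg.
have dgl := is_derive1_comp dg dl.
have -> : (fun t => k * g n (a * (coord i x + t * (i == j)%:R) + b)) =
   k \*: (g n \o l) by [].
rewrite deriveZ//= derive_val /l mul0r addr0.
by rewrite -[k *: _]/(k * _); ring.
Qed.

Lemma smooth_tower (g : nat -> R -> R) : derivation_tower g ->
  forall n k a b i, smooth (fun x => k * g n (a * coord i x + b)).
Proof.
move=> hg n k a b i s x.
have [m [k' ->]] : exists m k', pderiv s (fun x => k * g n (a * coord i x + b))
    = fun x => k' * g m (a * coord i x + b).
  elim: s => [|j s [m [k' IH]]]; first by exists n, k.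
  exists m.+1, (k' * (i == j)%:R * a).
  by rewrite -cat1s pderiv_cat IH pderiv_tower.
have dl : differentiable (fun x => a * coord i x + b) x.
  apply: differentiableD => //; apply: differentiableM => //.
  exact/linear_differentiable/coord_continuous.
apply: differentiableM => //.
apply: (@differentiable_comp _ _ _ _ (fun x => a * coord i x + b) (g m)) => //.
by apply/derivable1_diffP; have := hg m (a * coord i x + b) => -[].
Qed.

Definition affine_tower (n : nat) (t : R) : R :=
  match n with 0%N => t | 1%N => 1 | _ => 0 end.

Lemma affine_towerP : derivation_tower affine_tower.
Proof.
move=> [|[|n]] t; [exact: is_derive_id|exact: is_derive_cst..].
Qed.

Lemma smooth_affine a b i : smooth (fun x => a * coord i x + b).
Proof.
have := smooth_tower affine_towerP 0 1 a b i.
by under eq_fun do rewrite mul1r.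
Qed.

Lemma pderiv_affine a b i j :
  pderiv [:: j] (fun x => a * coord i x + b) = cst ((i == j)%:R * a).
Proof.
have := pderiv_tower affine_towerP 0 1 a b i j.
under eq_fun do rewrite mul1r.
by move=> ->; apply/funext => x /=; rewrite mul1r mulr1.
Qed.

Lemma smooth_cst (a : R) : smooth (cst a : R3 R -> R).
Proof.
have := smooth_affine 0 a ord0.
by under eq_fun do rewrite mul0r add0r.
Qed.

Lemma smooth_coord i : smooth (@coord R i).
Proof.
have := smooth_affine 1 0 i.
by under eq_fun do rewrite mul1r addr0.
Qed.

Lemma pderiv_coord i j : pderiv [:: j] (@coord R i) = cst (i == j)%:R.
Proof.
have := pderiv_affine 1 0 i j.
under eq_fun do rewrite mul1r addr0.
by rewrite mulr1.
Qed.

Lemma pderiv_cst (a : R) j : pderiv [:: j] (cst a : R3 R -> R) = cst 0.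
Proof.
have := pderiv_affine 0 a ord0 j.
under eq_fun do rewrite mul0r add0r.
by rewrite mulr0.
Qed.

Lemma derive_along f x v t : derivable f (x + t *: v) v ->
  is_derive t 1 (fun s => f (x + s *: v)) ('D_v f (x + t *: v)).
Proof.
have E : (fun h => h^-1 *: (((fun s => f (x + s *: v)) \o shift t)
    (h *: 1) - f (x + t *: v))) =
   (fun h => h^-1 *: ((f \o shift (x + t *: v)) (h *: v) - f (x + t *: v))).
  apply/funext => h /=; congr (_ *: (f _ - _)).
  by rewrite -[h *: 1]/(h * 1) mulr1 scalerDl addrCA.
by move=> df; split; rewrite /derivable /derive E.
Qed.

Lemma MVT_along f x v (h : R) : (forall y, derivable f y v) -> 0 < h ->
  exists2 c, 0 < c < h & f (x + h *: v) - f x = h * 'D_v f (x + c *: v).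
Proof.
move=> df h0.
have dl t := derive_along (df (x + t *: v)).
have [|c + E] := MVT h0 (fun t _ => dl t).
  by apply: derivable_within_continuous => t _; have [] := dl t.
rewrite in_itv /= => ch; exists c => //.
by move: E; rewrite scale0r addr0 subr0 mulrC.
Qed.

(** Two applications of the mean value theorem, first in the direction i and
    then in the direction j.  Exchanging i and j leaves the left-hand side
    unchanged, which is what makes mixed derivatives commute. *)
Lemma second_difference f i j x (h : R) : smooth f -> 0 < h ->
  exists c, [/\ 0 < c.1 < h, 0 < c.2 < h &
    f (x + h *: basis_vec i + h *: basis_vec j) - f (x + h *: basis_vec i)
    - (f (x + h *: basis_vec j) - f x) =
    h ^+ 2 * pderiv [:: j; i] f (x + c.1 *: basis_vec i + c.2 *: basis_vec j)].
Proof.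
move=> sf h0; pose w : R3 R := h *: basis_vec j.
have dsh y v : is_derive y v (fun z => f (z + w)) ('D_v f (y + w)).
  have E : (fun k => k^-1 *: (((fun z => f (z + w)) \o shift y) (k *: v) - f (y + w))) =
    (fun k => k^-1 *: ((f \o shift (y + w)) (k *: v) - f (y + w))).
    by apply/funext => k /=; rewrite addrA.
  have df : derivable f (y + w) v by exact: smooth_derivable.
  by split; rewrite /derivable /derive E.
pose g := (fun z => f (z + w)) - f.
have dg y v : is_derive y v g ('D_v f (y + w) - 'D_v f y).
  by apply: is_deriveB; exact/derivableP/smooth_derivable.
have [|c1 hc1 E1] := @MVT_along g x (basis_vec i) h _ h0.
  by move=> y; have [] := dg y (basis_vec i).
have [|c2 hc2 E2] := @MVT_along (pderiv [:: i] f) (x + c1 *: basis_vec i) (basis_vec j) h _ h0.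
  by move=> y; exact/smooth_derivable/smooth_pderiv.
exists (c1, c2); split => //.
move: E1; rewrite derive_val => E1.
rewrite [LHS]E1 -/(pderiv [:: i] f _) -/(pderiv [:: i] f _) E2.
by rewrite mulrA expr2.
Qed.

Lemma norm_basis_vec i : `|basis_vec i : R3 R| <= 1.
Proof.
rewrite /basis_vec /Num.norm /= /Num.norm /=.
by case: i => [[|[|[|//]]] ?] /=;
  rewrite !ge_max ?normr1 ?normr0 ?ler01 ?lexx.
Qed.

(** Schwarz's theorem. *)
Lemma pderivC f i j : smooth f -> pderiv [:: i; j] f = pderiv [:: j; i] f.
Proof.
move=> sf; apply/funext => x.
suff H (e : R) : 0 < e ->
    `|pderiv [:: i; j] f x - pderiv [:: j; i] f x| <= e.
  apply/eqP; rewrite -subr_eq0 -normr_le0.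
  by apply/ler_addgt0Pr => e e0; rewrite add0r; exact: H.
move=> e0.
have cont k l : \forall y \near x,
    `|pderiv [:: k; l] f x - pderiv [:: k; l] f y| < e / 2.
  have /cvgrPdist_lt := @smooth_continuous _ (smooth_pderiv [:: k; l] sf) x.
  by apply; rewrite divr_gt0.
have /nbhs_ballP[r r0 hr] : nbhs x [set y |
    `|pderiv [:: i; j] f x - pderiv [:: i; j] f y| < e / 2 /\
    `|pderiv [:: j; i] f x - pderiv [:: j; i] f y| < e / 2].
  by apply: filterI; exact: cont.
rewrite /= in r0; pose h := r / 2; have h0 : 0 < h by rewrite divr_gt0.
have inball (c : R * R) k l : 0 < c.1 < h -> 0 < c.2 < h ->
    ball x r (x + c.1 *: basis_vec k + c.2 *: basis_vec l).
  move=> /andP[c10 c1h] /andP[c20 c2h].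
  rewrite -ball_normE /= -addrA opprD addNKr normrN.
  apply: (le_lt_trans (ler_normD _ _)).
  rewrite !normrZ !gtr0_norm// (splitr r) ltrD//.
    by rewrite (le_lt_trans _ c1h)// ler_piMr ?norm_basis_vec// ltW.
  by rewrite (le_lt_trans _ c2h)// ler_piMr ?norm_basis_vec// ltW.
have [c [c1 c2 E1]] := second_difference i j x sf h0.
have [d [d1 d2 E2]] := second_difference j i x sf h0.
have B1 : `|pderiv [:: j; i] f x -
    pderiv [:: j; i] f (x + c.1 *: basis_vec i + c.2 *: basis_vec j)| < e / 2.
  exact: (hr _ (inball _ i j c1 c2)).2.
have B2 : `|pderiv [:: i; j] f x -
    pderiv [:: i; j] f (x + d.1 *: basis_vec j + d.2 *: basis_vec i)| < e / 2.
  exact: (hr _ (inball _ j i d1 d2)).1.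
move: E1 E2 B1 B2.
move: (pderiv [:: j; i] f) (pderiv [:: i; j] f) => B A E1 E2 B1 B2.
have sub4 (p q r1 r2 : R) : p - q - (r1 - r2) = p - r1 - (q - r2) by ring.
have E : B (x + c.1 *: basis_vec i + c.2 *: basis_vec j) =
    A (x + d.1 *: basis_vec j + d.2 *: basis_vec i).
  apply: (@mulfI _ (h ^+ 2)); first by rewrite expf_neq0// gt_eqF.
  by rewrite -E1 -E2 (addrAC x (h *: basis_vec j)) sub4.
rewrite E distrC in B1.
apply: le_trans (ler_distD (A (x + d.1 *: basis_vec j + d.2 *: basis_vec i)) _ _) _.
rewrite (splitr e); apply/ltW/ltrD; [exact: B2|exact: B1].
Qed.

End Calculus.

(** * Smooth bumps over boxes *)

Section Bump.
Context {R : realType}.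
Implicit Types (p : {poly R}) (t y : R).

(** The classical flat function exp(- 1/t) with a polynomial factor in 1/t: this
    family is closed under differentiation. *)
Definition expinv p t : R := if 0 < t then p.[t^-1] * expR (- t^-1) else 0.

Lemma expR_ge_exprn y n : 0 <= y -> y ^+ n <= n`!%:R * expR y.
Proof.
move=> y0; case: n => [|n].
  by rewrite expr0 fact0 mul1r; apply: le_trans (expR_ge1Dx y); rewrite lerDl.
rewrite mulrC -ler_pdivrMr ?ltr0n ?fact_gt0//.
by apply: le_trans (expR_ge1Dxn n y0); rewrite lerDr.
Qed.

(** The quadratic decay at 0 makes the function and all its derivatives vanish
    there; it comes from y^(k+2) <= (k+2)! exp y with y = 1/t. *)
Lemma expinv_le_sqr p : exists2 C, 0 < C & forall t, `|expinv p t| <= C * t ^+ 2.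
Proof.
pose C := 1 + \sum_(k < size p) `|p`_k| * (k.+2)`!%:R.
exists C => [|t].
  by rewrite ltr_pwDl// sumr_ge0// => k _; rewrite mulr_ge0.
rewrite /expinv; case: ifPn => [t0|_]; last first.
  by rewrite normr0 mulr_ge0 ?sqr_ge0// addr_ge0// sumr_ge0// => k _; rewrite mulr_ge0.
have y0 : 0 <= t^-1 by rewrite invr_ge0 ltW.
rewrite normrM (@ger0_norm _ (expR _)) ?expR_ge0// expRN.
rewrite ler_pdivrMr ?expR_gt0//.
rewrite horner_coef (le_trans (ler_norm_sum _ _ _))//.
apply: (@le_trans _ _ (\sum_(k < size p) `|p`_k| * (k.+2)`!%:R * t ^+ 2 * expR t^-1)).
  apply: ler_sum => k _; rewrite normrM -!(mulrA `|p`_k|) ler_wpM2l// normrX (ger0_norm y0).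
  have t2 : 0 < t^-1 ^+ 2 by rewrite exprn_gt0// invr_gt0.
  rewrite mulrAC mulrC -(invrK (t ^+ 2)) -exprVn ler_pdivlMl// -exprD add2n.
  exact: expR_ge_exprn.
rewrite -!mulr_suml /C mulrDl mul1r mulrDl ler_wpDl//.
by rewrite mulr_ge0 ?sqr_ge0 ?expR_ge0.
Qed.

Lemma is_derive_expinv p t :
  is_derive t 1 (expinv p) (expinv ('X^2 * (p - p^`())) t).
Proof.
have [t0|t0|->] := ltgtP t 0.
- rewrite [X in is_derive _ _ _ X]/expinv ltNge (ltW t0) /=.
  apply: (@near_eq_is_derive _ _ _ (cst 0)).
  near=> s; rewrite /expinv; case: ifPn => // s0.
  suff : s < 0 by move/(lt_trans s0); rewrite ltxx.
  by near: s; exact: lt_nbhsl.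
- apply: (@near_eq_is_derive _ _ _ ((horner p \o GRing.inv) * (expR \o (-%R \o GRing.inv)))).
    near=> s; rewrite /expinv ifT//.
    by near: s; exact: lt_nbhsr.
  rewrite /expinv t0.
  have tn0 : t != 0 by rewrite gt_eqF.
  have dV : is_derive t 1 (GRing.inv : R -> R) (- t ^- 2).
    split; first exact: derivableV.
    rewrite (@deriveV _ _ id)// ?derive_id.
    by rewrite -[_ *: 1]/(_ * 1) mulr1.
  have dp : is_derive t^-1 1 (horner p) (p^`().[t^-1]) by exact: is_derive_poly.
  have dN : is_derive t 1 (-%R \o (GRing.inv : R -> R)) (- - t ^- 2).
    exact: is_deriveN.
  apply: is_derive_eq.
  rewrite /= !hornerE exprVn.
  transitivity (p.[t^-1] * (expR (- t^-1) * (- - t ^- 2)) +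
    expR (- t^-1) * (p^`().[t^-1] * (- t ^- 2))); first by [].
  ring.
- rewrite [X in is_derive _ _ _ X]/expinv ltxx.
  have [C C0 HC] := expinv_le_sqr p.
  suff H : (fun h : R => h^-1 *: ((expinv p \o shift 0) (h *: (1:R)) - expinv p 0)) @ 0^' --> (0:R).
    split; first by apply/cvg_ex; exists 0.
    exact: cvg_lim H.
  apply/cvgrPdist_le => e e0; near=> h.
  have hn0 : h != 0 by near: h; exact: nbhs_dnbhs_neq.
  have -> : expinv p 0 = 0 by rewrite /expinv ltxx.
  rewrite /= addr0 sub0r normrN subr0 -[h *: 1]/(h * 1) mulr1 -[_ *: _]/(_ * _).
  rewrite normrM normfV ler_pdivrMl ?normr_gt0//.
  apply: (le_trans (HC h)).
  rewrite -(real_normK (num_real h)) expr2 mulrCA ler_wpM2l//.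
  rewrite -ler_pdivlMl//.
  near: h; apply: dnbhs0_le.
  by rewrite mulr_gt0// invr_gt0.
Unshelve. all: by end_near. Qed.


Definition expinv_tower n : R -> R :=
  expinv (iter n (fun p => 'X^2 * (p - p^`())) 1).

Lemma expinv_towerP : derivation_tower expinv_tower.
Proof. by move=> n t; exact: is_derive_expinv. Qed.

Lemma expinv_tower_le0 n t : t <= 0 -> expinv_tower n t = 0.
Proof. by move=> t0; rewrite /expinv_tower /expinv ltNge t0. Qed.

Lemma expinv_tower0E t : 0 < t -> expinv_tower 0 t = expR (- t^-1).
Proof. by move=> t0; rewrite /expinv_tower /expinv t0 /= hornerE mul1r. Qed.

Lemma expinv_tower0_ge0 t : 0 <= expinv_tower 0 t.
Proof.
have [t0|t0] := ltP 0 t; last by rewrite expinv_tower_le0.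
by rewrite expinv_tower0E// expR_ge0.
Qed.

Lemma expinv_tower0_le1 t : expinv_tower 0 t <= 1.
Proof.
have [t0|t0] := ltP 0 t; last by rewrite expinv_tower_le0.
by rewrite expinv_tower0E// expR_le1 oppr_le0 invr_ge0 ltW.
Qed.

Lemma expinv_tower0_ge t : 0 < t -> 1 - t^-1 <= expinv_tower 0 t.
Proof. by move=> t0; rewrite expinv_tower0E//; exact: expR_ge1Dx. Qed.

Lemma expinv_tower1_le2 t : `|expinv_tower 1 t| <= 2.
Proof.
have [t0|t0] := ltP 0 t; last by rewrite expinv_tower_le0// normr0.
rewrite /expinv_tower /expinv t0 /= derivC subr0 mulr1 !hornerE.
have y0 : 0 <= t^-1 by rewrite invr_ge0 ltW.
rewrite ger0_norm ?mulr_ge0 ?expR_ge0//.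
rewrite expRN ler_pdivrMr ?expR_gt0//.
have := @expR_ge_exprn t^-1 2 y0.
exact.
Qed.

Implicit Types (f g : R3 R -> R) (x : R3 R) (i j : 'I_3) (N a b : R).

(** A smooth function of x_i supported in [a, b], which tends to 1 on ]a, b[ when
    the steepness N grows.  Its two factors vanish as soon as x_i is within 1/N
    of an end point, which makes the support compact in ]a, b[. *)
Definition slab N a b i : R3 R -> R :=
  (fun x => 1 * expinv_tower 0 (- N * coord i x + (N * b - 1))) *
  (fun x => 1 * expinv_tower 0 (N * coord i x + (- N * a - 1))).

Lemma smooth_slab N a b i : smooth (slab N a b i).
Proof. by apply: smoothM; exact: (smooth_tower expinv_towerP). Qed.

Lemma slab_ge0 N a b i x : 0 <= slab N a b i x.
Proof. by rewrite /slab !fctE !mul1r mulr_ge0// expinv_tower0_ge0. Qed.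

Lemma slab_le1 N a b i x : slab N a b i x <= 1.
Proof.
by rewrite /slab !fctE !mul1r mulr_ile1// ?expinv_tower0_ge0// expinv_tower0_le1.
Qed.

Lemma pderiv_slab N a b i j : pderiv [:: j] (slab N a b i) =
  (fun x => (i == j)%:R * (- N * expinv_tower 1 (- N * coord i x + (N * b - 1))
     * expinv_tower 0 (N * coord i x + (- N * a - 1))
     + N * expinv_tower 0 (- N * coord i x + (N * b - 1))
     * expinv_tower 1 (N * coord i x + (- N * a - 1)))).
Proof.
rewrite pderivM; [|exact: (smooth_tower expinv_towerP)..].
rewrite !(pderiv_tower expinv_towerP); apply/funext => x.
rewrite !fctE; ring.
Qed.

Lemma pderiv_slab_le N a b i j x : 0 < N ->
  `|pderiv [:: j] (slab N a b i) x| <= 4 * N.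
Proof.
move=> N0; rewrite pderiv_slab normrM.
apply: (@le_trans _ _ (1 * (2 * N + 2 * N))); last by rewrite mul1r; lra.
apply: ler_pM => //; first by case: eqP => _; rewrite ?normr1 ?normr0.
apply: (le_trans (ler_normD _ _)); rewrite !normrM normrN (gtr0_norm N0).
rewrite !(ger0_norm (expinv_tower0_ge0 _)); apply: lerD.
  rewrite (mulrC N) -[leRHS]mulr1 ler_pM ?mulr_ge0 ?(ltW N0) ?expinv_tower0_ge0 ?expinv_tower0_le1//.
  by rewrite ler_wpM2r ?(ltW N0)// expinv_tower1_le2.
rewrite mulrC ler_pM ?mulr_ge0 ?(ltW N0) ?expinv_tower0_ge0 ?expinv_tower1_le2//.
by rewrite ler_piMr ?(ltW N0)// expinv_tower0_le1.
Qed.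

Lemma slab_out N a b i x : 0 < N -> ~~ (a < coord i x < b) -> slab N a b i x = 0.
Proof.
move=> N0; rewrite negb_and -!leNgt /slab !fctE => /orP[xa|bx].
  rewrite mulrC (expinv_tower_le0 0 (_ : N * _ + _ <= 0)) ?mulr0 ?mul0r//.
  have := ler_wpM2l (ltW N0) xa; lra.
rewrite (expinv_tower_le0 0 (_ : - N * _ + _ <= 0)) ?mulr0 ?mul0r//.
have := ler_wpM2l (ltW N0) bx; lra.
Qed.

Lemma pderiv_slab_out N a b i j x : 0 < N -> ~~ (a < coord i x < b) ->
  pderiv [:: j] (slab N a b i) x = 0.
Proof.
move=> N0; rewrite negb_and -!leNgt pderiv_slab => /orP[xa|bx].
  have H : N * coord i x + (- N * a - 1) <= 0.
    have := ler_wpM2l (ltW N0) xa; lra.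
  by rewrite !(expinv_tower_le0 _ H) !mulr0 addr0 mulr0.
have H : - N * coord i x + (N * b - 1) <= 0.
  have := ler_wpM2l (ltW N0) bx; lra.
by rewrite !(expinv_tower_le0 _ H) !(mulr0, mul0r) addr0 mulr0.
Qed.

(** Quantifies the plateau: exp(- 1/s) >= 1 - 1/s for both factors. *)
Lemma slab_ge N a b i x M : 0 < M -> M + 1 <= N * (b - coord i x) ->
  M + 1 <= N * (coord i x - a) -> 1 - 2 / M <= slab N a b i x.
Proof.
move=> M0 Hb Ha; rewrite /slab !fctE !mul1r.
set s := - N * _ + _; set t := N * _ + _.
have Ms : M <= s by rewrite /s; lra.
have Mt : M <= t by rewrite /t; lra.
have es := expinv_tower0_ge (lt_le_trans M0 Ms).
have et := expinv_tower0_ge (lt_le_trans M0 Mt).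
have Ms' : s^-1 <= M^-1 by rewrite lef_pV2// posrE (lt_le_trans M0).
have Mt' : t^-1 <= M^-1 by rewrite lef_pV2// posrE (lt_le_trans M0).
have := expinv_tower0_le1 s; have := expinv_tower0_le1 t.
move: es et; set A := expinv_tower 0 s; set B := expinv_tower 0 t => es et B1 A1.
have : 0 <= (1 - A) * (1 - B) by rewrite mulr_ge0// subr_ge0.
lra.
Qed.

Definition box_bump N (lo hi : 'I_3 -> R) : R3 R -> R :=
  \prod_(i < 3) slab N (lo i) (hi i) i.

Definition open_box (lo hi : 'I_3 -> R) : set (R3 R) :=
  [set x | forall i, lo i < coord i x < hi i].

Lemma smooth_prod (I : Type) (r : seq I) (F : I -> R3 R -> R) :
  (forall k, smooth (F k)) -> smooth (\prod_(k <- r) F k).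
Proof.
move=> sF; elim/big_rec: _ => [|i f _ sf]; first exact: (smooth_cst 1).
exact: smoothM.
Qed.

Lemma box_bumpE N lo hi x :
  box_bump N lo hi x = \prod_(i < 3) slab N (lo i) (hi i) i x.
Proof. by rewrite /box_bump fct_prodE. Qed.

Lemma smooth_box_bump N lo hi : smooth (box_bump N lo hi).
Proof. by apply: smooth_prod => i; exact: smooth_slab. Qed.

Lemma box_bump_ge0 N lo hi x : 0 <= box_bump N lo hi x.
Proof. by rewrite box_bumpE prodr_ge0// => i _; exact: slab_ge0. Qed.

Lemma box_bump_le1 N lo hi x : box_bump N lo hi x <= 1.
Proof.
by rewrite box_bumpE numdomain.Num.Theory.prodr_ile1// => i _; rewrite slab_ge0 slab_le1.
Qed.

Lemma box_bump_out N lo hi x : 0 < N -> ~ open_box lo hi x ->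
  box_bump N lo hi x = 0.
Proof.
move=> N0 /existsNP[i /negP xi]; rewrite box_bumpE (bigD1 i)//=.
by rewrite slab_out ?mul0r.
Qed.

(** Stated for any list of coordinates so that it can be proved by induction on
    the product. *)
Lemma pderiv_slab_prod_le N lo hi (r : seq 'I_3) j x : 0 < N ->
  `|pderiv [:: j] (\prod_(i <- r) slab N (lo i) (hi i) i) x|
    <= (size r)%:R * (4 * N).
Proof.
move=> N0; elim: r => [|i r IH].
  by rewrite big_nil (_ : 1 = cst 1)// pderiv_cst normr0 mul0r.
rewrite big_cons pderivM; last 2 first.
- exact: smooth_slab.
- by apply: smooth_prod => k; exact: smooth_slab.
have HP : `|(\prod_(k <- r) slab N (lo k) (hi k) k) x| <= 1.
  rewrite fct_prodE normr_prod.
  apply: numdomain.Num.Theory.prodr_ile1 => k _.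
  by rewrite ger0_norm slab_ge0//= slab_le1.
have HF : `|slab N (lo i) (hi i) i x| <= 1 by rewrite ger0_norm ?slab_ge0// slab_le1.
have HD := pderiv_slab_le (lo i) (hi i) i j x N0.
rewrite !fctE; move: HP HF HD IH; move: (pderiv _ _ x) (pderiv _ _ x) (_ x) (_ x).
move=> d p' P F HP HF HD IH.
rewrite (le_trans (ler_normD _ _))// -[size _]/(size r).+1 -natr1 mulrDl mul1r addrC.
rewrite !normrM; apply: lerD.
  by rewrite -[leRHS]mul1r ler_pM.
by rewrite -[leRHS]mulr1 ler_pM.
Qed.

Lemma pderiv_slab_prod_out N lo hi (r : seq 'I_3) k j x : 0 < N ->
  k \in r -> ~~ (lo k < coord k x < hi k) ->
  pderiv [:: j] (\prod_(i <- r) slab N (lo i) (hi i) i) x = 0.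
Proof.
move=> N0 + kout; elim: r => // i r IH; rewrite in_cons big_cons pderivM; last 2 first.
- exact: smooth_slab.
- by apply: smooth_prod => l; exact: smooth_slab.
rewrite !fctE => /predU1P[<-|kr].
  by rewrite pderiv_slab_out// slab_out// !mul0r addr0.
rewrite IH// mulr0 addr0 fct_prodE (perm_big _ (perm_to_rem kr)) big_cons /=.
by rewrite slab_out// mul0r mulr0.
Qed.

Lemma pderiv_box_bump_le N lo hi j x : 0 < N ->
  `|pderiv [:: j] (box_bump N lo hi) x| <= 12 * N.
Proof.
move=> N0; have := pderiv_slab_prod_le lo hi (index_enum 'I_3) j x N0.
have -> : size (index_enum 'I_3) = 3%N by rewrite -[RHS](size_enum_ord 3) enumT [index_enum _]unlock.
by rewrite mulrA -natrM.
Qed.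

Lemma pderiv_box_bump_out N lo hi j x : 0 < N -> ~ open_box lo hi x ->
  pderiv [:: j] (box_bump N lo hi) x = 0.
Proof.
move=> N0 /existsNP[k /negP xk].
exact: (pderiv_slab_prod_out _ N0 (mem_index_enum k)).
Qed.

Lemma box_bump_ge N lo hi x M : 2 <= M ->
  (forall i, M + 1 <= N * (hi i - coord i x)) ->
  (forall i, M + 1 <= N * (coord i x - lo i)) ->
  1 - 6 / M <= box_bump N lo hi x.
Proof.
move=> M2 Hb Ha; have M0 : 0 < M by lra.
have H i : 1 - 2 / M <= slab N (lo i) (hi i) i x by exact: slab_ge.
have d0 : 0 <= 1 - 2 / M by rewrite subr_ge0 ler_pdivrMr// mul1r.
rewrite box_bumpE; apply: (@le_trans _ _ (\prod_(i < 3) (1 - 2 / M))).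
  rewrite prodr_const card_ord.
  have d1 : 0 <= 2 / M by rewrite divr_ge0// ltW.
  have -> : 6 / M = 3 * (2 / M) by rewrite mulrA -natrM.
  move: d0 d1; set d := 2 / M => d0 d1; rewrite subr_ge0 in d0.
  have -> : (1 - d) ^+ 3 = 1 - 3 * d + d ^+ 2 * (3 - d) by ring.
  by rewrite lerDl mulr_ge0 ?sqr_ge0//; lra.
by apply: ler_prod => i _; rewrite d0 H.
Qed.
End Bump.

(** * Square integrable functions *)

Section SquareIntegrable.
Context {d} {T : measurableType d} {R : realType}.
Variable mu : {measure set T -> \bar R}.
Variable D : set T.
Hypothesis mD : measurable D.
Implicit Types f g : T -> R.

Definition sq_integrable f :=
  measurable_fun D f /\ mu.-integrable D (fun x => (f x ^+ 2)%:E).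

Lemma sq_integrableM f g : sq_integrable f -> sq_integrable g ->
  mu.-integrable D (EFin \o (f * g)).
Proof.
move=> [mf If] [mg Ig].
apply: (@le_integrable _ _ _ _ _ _ _ (fun x => (f x ^+ 2 + g x ^+ 2)%:E)) => //.
- exact/measurable_EFinP/measurable_funM.
- move=> x _ /=; rewrite lee_fin (ger0_norm (addr_ge0 (sqr_ge0 _) (sqr_ge0 _))).
  rewrite normrM -(real_normK (num_real (f x))) -(real_normK (num_real (g x))).
  have := sqr_ge0 (`|f x| - `|g x|); have := normr_ge0 (f x); have := normr_ge0 (g x).
  by nra.
- by under eq_fun do rewrite EFinD; exact: integrableD.
Qed.

Lemma sq_integrableZ k f : sq_integrable f -> sq_integrable (fun x => k * f x).
Proof.
move=> [mf If]; split; first exact: measurable_funM.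
by under eq_fun do rewrite exprMn EFinM; exact: integrableZl.
Qed.

Lemma sq_integrableD f g :
  sq_integrable f -> sq_integrable g -> sq_integrable (f + g).
Proof.
move=> sf sg; have [mf If] := sf; have [mg Ig] := sg.
split; first exact: measurable_funD.
have -> : (fun x => ((f + g) x ^+ 2)%:E) =
   (fun x => ((f x ^+ 2)%:E + ((f x * g x)%:E + (f x * g x)%:E)) + (g x ^+ 2)%:E)%E.
  by apply/funext => x; rewrite !fctE -!EFinD; congr EFin; ring.
by do ! apply: integrableD => //; exact: sq_integrableM.
Qed.

Lemma sq_integrableB f g :
  sq_integrable f -> sq_integrable g -> sq_integrable (f - g).
Proof.
move=> sf sg; have -> : f - g = f + (fun x => -1 * g x).
  by apply/funext => x; rewrite !fctE mulN1r.
by apply: sq_integrableD => //; exact: sq_integrableZ.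
Qed.

Lemma sq_integral_ge0 f : 0 <= \int[mu]_(x in D) (f x ^+ 2).
Proof. by apply: Rintegral_ge0 => x _; exact: sqr_ge0. Qed.

Lemma sq_integral_expand f g t : sq_integrable f -> sq_integrable g ->
  \int[mu]_(x in D) ((f x - t * g x) ^+ 2) = \int[mu]_(x in D) (f x ^+ 2)
   - 2 * t * \int[mu]_(x in D) (f x * g x) + t ^+ 2 * \int[mu]_(x in D) (g x ^+ 2).
Proof.
move=> sf sg; have [mf If] := sf; have [mg Ig] := sg.
have Ifg := sq_integrableM sf sg.
have -> : (fun x => (f x - t * g x) ^+ 2) =
  (fun x => f x ^+ 2 - 2 * t * (f x * g x) + t ^+ 2 * g x ^+ 2).
  by apply/funext => x; ring.
have I1 : mu.-integrable D (EFin \o (fun x => 2 * t * (f x * g x))).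
  exact: (integrableZl mD (2 * t) Ifg).
have I2 : mu.-integrable D (EFin \o (fun x => t ^+ 2 * g x ^+ 2)).
  exact: (integrableZl mD (t ^+ 2) Ig).
rewrite RintegralD//; last exact: (integrableB mD If I1).
by rewrite RintegralB// !RintegralZl.
Qed.

(** The discriminant of the nonnegative quadratic t |-> int (f - t g)^2. *)
Lemma cauchy_schwarz f g : sq_integrable f -> sq_integrable g ->
  (\int[mu]_(x in D) (f x * g x)) ^+ 2 <=
  \int[mu]_(x in D) (f x ^+ 2) * \int[mu]_(x in D) (g x ^+ 2).
Proof.
move=> sf sg.
have H t : 0 <= \int[mu]_(x in D) (f x ^+ 2) -
    2 * t * \int[mu]_(x in D) (f x * g x) + t ^+ 2 * \int[mu]_(x in D) (g x ^+ 2).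
  by rewrite -sq_integral_expand// sq_integral_ge0.
have := sq_integral_ge0 g; have := sq_integral_ge0 f.
move: H; set A := \int[mu]_(x in D) (f x ^+ 2).
set B := \int[mu]_(x in D) (f x * g x); set C := \int[mu]_(x in D) (g x ^+ 2).
move: A B C => A B C H A0.
rewrite le_eqVlt => /predU1P[C0|C0].
  rewrite -C0 mulr0; have [->|B0] := eqVneq B 0; first by rewrite expr0n.
  have := H ((A + 1) / (2 * B)); rewrite -C0 mulr0 addr0.
  have -> : 2 * ((A + 1) / (2 * B)) * B = A + 1 by field.
  by lra.
have := H (B / C).
have -> : A - 2 * (B / C) * B + (B / C) ^+ 2 * C = (A * C - B ^+ 2) / C.
  by field; rewrite gt_eqF.
by rewrite pmulr_lge0 ?invr_gt0// subr_ge0.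
Qed.

Lemma sq_integralD_le f g : sq_integrable f -> sq_integrable g ->
  \int[mu]_(x in D) ((f x + g x) ^+ 2) <=
  2 * \int[mu]_(x in D) (f x ^+ 2) + 2 * \int[mu]_(x in D) (g x ^+ 2).
Proof.
move=> sf sg; rewrite -subr_ge0.
have := sq_integral_ge0 (fun x => f x - 1 * g x); rewrite sq_integral_expand//.
have := sq_integral_expand (- 1) sf sg.
have -> : (fun x => (f x - -1 * g x) ^+ 2) = (fun x => (f x + g x) ^+ 2).
  by apply/funext => x; ring.
by move=> ->; lra.
Qed.

Hypothesis finD : (mu D < +oo)%E.

Lemma cst_integrable (M : R) : mu.-integrable D (EFin \o cst M).
Proof. by apply: measurable_bounded_integrable => //; exact: bounded_cst. Qed.

Lemma bounded_integrable f M : measurable_fun D f ->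
  (forall x, D x -> `|f x| <= M) -> mu.-integrable D (EFin \o f).
Proof.
move=> mf fM.
apply: (@le_integrable _ _ _ _ _ _ _ (EFin \o cst M)) => //.
- exact/measurable_EFinP.
- by move=> x Dx /=; rewrite lee_fin (le_trans (fM _ Dx))// ler_norm.
- exact: cst_integrable.
Qed.

Lemma bounded_sq_integrable f M : measurable_fun D f ->
  (forall x, D x -> `|f x| <= M) -> sq_integrable f.
Proof.
move=> mf fM; split => //; apply: (@bounded_integrable (fun x => f x ^+ 2) (M ^+ 2)).
  exact: measurable_funX.
move=> x Dx; rewrite normrX ler_pXn2r ?nnegrE// ?fM//.
exact: le_trans (fM _ Dx).
Qed.

Lemma bounded_sq_integral_le f M : measurable_fun D f ->
  (forall x, D x -> `|f x| <= M) ->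
  \int[mu]_(x in D) (f x ^+ 2) <= M ^+ 2 * fine (mu D).
Proof.
move=> mf fM; rewrite -Rintegral_cst//; apply: le_Rintegral => //.
- by have [] := bounded_sq_integrable mf fM.
- exact: cst_integrable.
- move=> x Dx; rewrite -real_normK ?num_real// ler_pXn2r ?nnegrE// ?fM//.
  exact: le_trans (fM _ Dx).
Qed.

Lemma sq_integrable_bounded_mul f g M : sq_integrable f -> measurable_fun D g ->
  (forall x, D x -> `|g x| <= M) -> sq_integrable (f * g).
Proof.
move=> [mf If] mg gM; split; first exact: measurable_funM.
apply: (@le_integrable _ _ _ _ _ _ _ (fun x => ((M * f x) ^+ 2)%:E)) => //.
- exact/measurable_EFinP/measurable_funX/measurable_funM.
- move=> x Dx; rewrite -[X in (X <= _)%E]/((`|(f * g) x ^+ 2|)%:E).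
  rewrite -[X in (_ <= X)%E]/((`|(M * f x) ^+ 2|)%:E) lee_fin.
  rewrite !normrX ler_pXn2r ?nnegrE//.
  rewrite !fctE !normrM mulrC ler_wpM2r//.
  exact: le_trans (gM _ Dx) (ler_norm _).
- by have [] := sq_integrableZ M (conj mf If).
Qed.

End SquareIntegrable.

(** * Boxes and Lebesgue measure in dimension three *)

Section Boxes.
Context {R : realType}.
Implicit Types (x c : R3 R) (i j k : 'I_3) (lo hi : 'I_3 -> R) (h : R) (O : set (R3 R)).

Definition closed_box lo hi : set (R3 R) :=
  [set x | forall i, lo i <= coord i x <= hi i].

Lemma forall_ord3 (P : 'I_3 -> Prop) :
  (forall i, P i) <-> [/\ P 0, P 1 & P 2].
Proof.
split=> [H|[P0 P1 P2] i]; first by split.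
have : i = 0 \/ i = 1 \/ i = 2.
  case: i => [[|[|[|//]]] ?]; [left|right;left|right;right]; exact/val_inj.
by case=> [->|[->|->]].
Qed.

Lemma open_boxE lo hi : open_box lo hi =
  (`]lo 0, hi 0[ `*` `]lo 1, hi 1[) `*` `]lo 2, hi 2[.
Proof.
apply/seteqP; split=> x; rewrite /open_box /= ?in_itv /=.
  by move=> H; split; [split|]; [exact: (H 0)|exact: (H 1)|exact: (H 2)].
by move=> [[H0 H1] H2]; apply/forall_ord3; split.
Qed.

Lemma closed_boxE lo hi : closed_box lo hi =
  (`[lo 0, hi 0] `*` `[lo 1, hi 1]) `*` `[lo 2, hi 2].
Proof.
apply/seteqP; split=> x; rewrite /closed_box /= ?in_itv /=.
  by move=> H; split; [split|]; [exact: (H 0)|exact: (H 1)|exact: (H 2)].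
by move=> [[H0 H1] H2]; apply/forall_ord3; split.
Qed.

Lemma compact_closed_box lo hi : compact (closed_box lo hi).
Proof.
rewrite closed_boxE; apply: compact_setX; last exact: segment_compact.
by apply: compact_setX; exact: segment_compact.
Qed.

Lemma measurable_open_box lo hi : measurable (open_box lo hi).
Proof.
rewrite open_boxE; apply: measurableX; last exact: measurable_itv.
by apply: measurableX; exact: measurable_itv.
Qed.

Lemma measurable_closed_box lo hi : measurable (closed_box lo hi).
Proof.
rewrite closed_boxE; apply: measurableX; last exact: measurable_itv.
by apply: measurableX; exact: measurable_itv.
Qed.

Lemma mu3_setX (A B C : set (measurableTypeR R)) :
  measurable A -> measurable B -> measurable C ->
  mu3 ((A `*` B) `*` C) =
  (@lebesgue_measure R A * @lebesgue_measure R B * @lebesgue_measure R C)%E.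
Proof.
move=> mA mB mC; have mAB : measurable (A `*` B) by exact: measurableX.
have -> : mu3 ((A `*` B) `*` C) = (((lebesgue_measure \x lebesgue_measure)%E
    (A `*` B)) * @lebesgue_measure R C)%E by exact: product_measure1E.
by congr (_ * _)%E; exact: product_measure1E.
Qed.

Lemma mu3_closed_box lo hi : (forall i, lo i <= hi i) ->
  mu3 (closed_box lo hi) = (\prod_(i < 3) (hi i - lo i))%:E.
Proof.
move=> lohi; rewrite closed_boxE mu3_setX; [|exact: measurable_itv..].
have E i : (lebesgue_measure (`[lo i, hi i]%classic : set R) = (hi i - lo i)%:E)%E.
  rewrite lebesgue_measure_itv /= lte_fin; have := lohi i.
  by rewrite le_eqVlt => /predU1P[->|->]; rewrite ?ltxx ?subrr.
rewrite !E -!EFinM; congr (_ %:E); rewrite !big_ord_recr big_ord0 /= mul1r.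
by congr ((hi _ - lo _) * (hi _ - lo _) * (hi _ - lo _)); exact/val_inj.
Qed.

Lemma mu3_open_box lo hi : (forall i, lo i <= hi i) ->
  mu3 (open_box lo hi) = (\prod_(i < 3) (hi i - lo i))%:E.
Proof.
move=> lohi; rewrite open_boxE mu3_setX; [|exact: measurable_itv..].
have E i : (lebesgue_measure (`]lo i, hi i[%classic : set R) = (hi i - lo i)%:E)%E.
  rewrite lebesgue_measure_itv /= lte_fin; have := lohi i.
  by rewrite le_eqVlt => /predU1P[->|->]; rewrite ?ltxx ?subrr.
rewrite !E -!EFinM; congr (_ %:E); rewrite !big_ord_recr big_ord0 /= mul1r.
by congr ((hi _ - lo _) * (hi _ - lo _) * (hi _ - lo _)); exact/val_inj.
Qed.

Lemma open_cube_box h c :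
  open_cube h c = open_box (fun i => coord i c - h) (fun i => coord i c + h).
Proof.
apply/seteqP; split=> x H i; have := H i; rewrite ltr_distl//.
Qed.

Lemma cube_box h c :
  cube h c = closed_box (fun i => coord i c - h) (fun i => coord i c + h).
Proof.
apply/seteqP; split=> x H i; have := H i; rewrite ler_distl//.
Qed.

Lemma open_open_cube h c : open (open_cube h c).
Proof.
pose A i := [set x : R3 R | `|coord i x - coord i c| < h].
have oA i : open (A i).
  apply: (@open_comp _ _ (fun x : R3 R => `|coord i x - coord i c|) [set y | y < h]).
    move=> x _; apply: cvg_norm; apply: cvgB; [exact: coord_continuous|exact: cvg_cst].
  exact: open_lt.
have -> : open_cube h c = A 0 `&` A 1 `&` A 2.
  apply/seteqP; split=> [x H|x [[H0 H1] H2]]; last by apply/forall_ord3; split.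
  by split; [split; exact: H|exact: H].
by apply: openI => //; exact: openI.
Qed.

Lemma cube_nbhs O x : open O -> O x -> exists2 r, 0 < r & cube r x `<=` O.
Proof.
move=> oO Ox; have /nbhs_ballP[r /= r0 rO] : nbhs x O by exact: open_nbhs_nbhs.
exists (r / 2); first by rewrite divr_gt0.
move=> y xy; apply: rO.
have H i : `|coord i x - coord i y| < r.
  by rewrite distrC (le_lt_trans (xy i))// ltr_pdivrMr// ltr_pMr// ltr1n.
by split; [split|]; rewrite -ball_normE /=; [exact: (H 0)|exact: (H 1)|exact: (H 2)].
Qed.

Definition rat_center (q : rat * rat * rat * rat) : R3 R :=
  (ratr q.1.1.1, ratr q.1.1.2, ratr q.1.2).

(** Makes every open set a countable union of boxes: this compares the product
    sigma-algebra with the topology, and reduces statements on an open set to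
    statements on boxes. *)
Lemma open_bigcup_cubes O : open O ->
  O = \bigcup_(q in [set q | cube (ratr q.2) (rat_center q) `<=` O])
        open_cube (ratr q.2) (rat_center q).
Proof.
move=> oO; apply/seteqP; split=> [x Ox|x [q /= qO] xq]; last first.
  by apply: qO => i; exact/ltW/xq.
have [r r0 rO] := cube_nbhs oO Ox.
have r20 : 0 < r / 2 by rewrite divr_gt0.
have [e] := rat_in_itvoo r20; rewrite in_itv /= => /andP[e0 er].
have near (t : R) : exists q : rat, `|t - ratr q| < ratr e.
  have [|q] := @rat_in_itvoo R (t - ratr e) (t + ratr e); first by lra.
  by rewrite in_itv /= => H; exists q; rewrite distrC ltr_distl.
have [q0 H0] := near x.1.1; have [q1 H1] := near x.1.2; have [q2 H2] := near x.2.
have xq : open_cube (ratr e) (rat_center (q0, q1, q2, e)) x.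
  by apply/forall_ord3; split.
exists (q0, q1, q2, e) => //= y yq; apply: rO => i.
apply: (le_trans (ler_distD (coord i (rat_center (q0, q1, q2, e))) _ _)).
rewrite (splitr r) lerD ?(le_trans (yq i)) ?(ltW er)//.
by rewrite distrC (le_trans (ltW (xq i)))// ltW.
Qed.

Lemma measurable_open_cube h c : measurable (open_cube h c).
Proof. by rewrite open_cube_box; exact: measurable_open_box. Qed.

Lemma measurable_cube h c : measurable (cube h c).
Proof. by rewrite cube_box; exact: measurable_closed_box. Qed.

(** The sigma-algebra on the space is defined as a product, so that the
    measurability of open sets is not part of its definition. *)
Lemma open_measurable3 O : open O -> measurable O.
Proof.
move=> /open_bigcup_cubes ->; rewrite bigcup_mkcond.
apply: countable_bigcupT_measurable => // q.
by case: ifPn => // _; exact: measurable_open_cube.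
Qed.

Lemma continuous_measurable3 (f : R3 R -> R) (D : set (R3 R)) :
  continuous f -> measurable_fun D f.
Proof.
move=> cf; apply: (@measurable_funS _ _ _ _ setT) => //.
apply: (measurability _ (RGenOpens.measurableE R)) => //.
move=> _ [_ [a [b ->] <-]]; rewrite setTI; apply: open_measurable3.
by apply: open_comp => [x _|]; [exact: cf|exact: interval_open].
Qed.

End Boxes.

(** * Test functions and integration by parts *)

Section TestFunctions.
Context {R : realType}.
Implicit Types (f g phi : R3 R -> R) (x : R3 R) (i j : 'I_3) (O K : set (R3 R)).

Lemma compact_closed3 K : compact K -> closed K.
Proof. by apply: compact_closed; exact: norm_hausdorff. Qed.

Lemma pderiv_support K f s : closed K -> (forall x, ~ K x -> f x = 0) ->
  forall x, ~ K x -> pderiv s f x = 0.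
Proof.
move=> cK f0; elim: s => [|i s IH] x Kx; first exact: f0.
rewrite -cat1s pderiv_cat /= (@near_eq_derive _ _ _ _ (cst 0)) ?derive_cst//.
have oK : open (~` K) by exact: closed_openC.
have : nbhs x (~` K) by exact: open_nbhs_nbhs.
by apply: filterS => y; exact: IH.
Qed.

Lemma test_pderiv O s phi : test_fun O phi -> test_fun O (pderiv s phi).
Proof.
move=> [sphi [K [cK KO K0]]]; split; first exact: smooth_pderiv.
by exists K; split => // x; exact: pderiv_support (compact_closed3 cK) K0 x.
Qed.

Lemma test_mul O phi g : test_fun O phi -> smooth g -> test_fun O (phi * g).
Proof.
move=> [sphi [K [cK KO K0]]] sg; split; first exact: smoothM.
by exists K; split => // x Kx; rewrite !fctE K0// mul0r.
Qed.

Lemma test_out O phi x : test_fun O phi -> ~ O x -> phi x = 0.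
Proof. by move=> [_ [K [_ KO K0]]] Ox; apply: K0 => /KO. Qed.

Lemma compact_bounded_norm K : compact K -> exists2 M, 0 < M & forall x, K x -> `|x| <= M.
Proof.
move=> /compact_bounded [M [_ HM]]; exists (`|M| + 1) => [|x Kx].
  by rewrite ltr_pwDr.
by apply: HM => //; rewrite ltr_pwDr// ler_norm.
Qed.

Lemma coord_le_norm i x : `|coord i x| <= `|x|.
Proof.
move: i; apply/forall_ord3; rewrite /coord /= [`|x|]prod_normE [`|x.1|]prod_normE.
by rewrite !le_max; split; rewrite lexx ?orbT.
Qed.

Lemma test_bounded O phi : test_fun O phi -> exists2 M, 0 < M & forall x, `|phi x| <= M.
Proof.
move=> [sphi [K [cK KO K0]]].
have : compact (phi @` K).
  apply: continuous_compact => //; apply: continuous_subspaceT.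
  exact: smooth_continuous.
move=> /compact_bounded [M [_ HM]]; exists (`|M| + 1) => [|x].
  by rewrite ltr_pwDr.
have [Kx|Kx] := pselect (K x).
  by apply: HM; [rewrite ltr_pwDr// ler_norm|exists x].
by rewrite K0// normr0 addr_ge0.
Qed.

Lemma test_box O phi : test_fun O phi ->
  exists2 M, 0 < M & forall x i, M < `|coord i x| -> phi x = 0.
Proof.
move=> [sphi [K [cK KO K0]]]; have [M M0 HM] := compact_bounded_norm cK.
exists M => // x i Mx; apply: K0 => Kx; move: Mx; rewrite ltNge => /negP; apply.
exact: le_trans (coord_le_norm _ _) (HM _ Kx).
Qed.

Lemma test_measurable O D phi : test_fun O phi -> measurable_fun D phi.
Proof. by move=> tphi; apply: continuous_measurable3; exact: (smooth_continuous tphi.1). Qed.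

(** The fundamental theorem of calculus on an interval that contains the
    support in its interior. *)
Lemma integral_derive_compact (g g' : R -> R) (M : R) :
  (forall t : R, is_derive t 1 g (g' t)) -> continuous g' ->
  (forall t, M < `|t| -> g t = 0) ->
  (\int[lebesgue_measure]_t (g' t)%:E = 0)%E.
Proof.
move=> dg cg' g0; pose N : R := `|M| + 1.
have MN (t : R) : N <= `|t| -> M < `|t|.
  by apply: lt_le_trans; rewrite /N ltr_pwDr// ler_norm.
have N0 : 0 < N by rewrite ltr_pwDr.
have g'0 (t : R) : N < `|t| -> g' t = 0.
  move=> Nt; have [_ <-] := dg t.
  rewrite (@near_eq_derive _ _ _ _ (cst 0)) ?derive_cst//.
  have : open [set s : R | N < `|s|].
    by apply: (@open_comp _ _ (fun s : R => `|s|) [set y | N < y]);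
      [by move=> s _; apply: cvg_norm|exact: open_gt].
  move=> oN; have : nbhs t [set s : R | N < `|s|] by exact: open_nbhs_nbhs.
  by apply: filterS => s /ltW /MN /g0.
have -> : (\int[lebesgue_measure]_t (g' t)%:E =
    \int[lebesgue_measure]_(t in `[(- N)%R, N]) (g' t)%:E)%E.
  rewrite [RHS]integral_mkcond; apply: eq_integral => t _; rewrite patchE.
  case: ifPn => // /negP tN; rewrite g'0// ltNge ler_norml.
  by apply/negP => Nt; apply: tN; rewrite inE /= in_itv.
rewrite (@continuous_FTC2 _ g' g).
- by rewrite !g0 ?subee// MN// ?normrN ger0_norm// ltW.
- by rewrite gtrN.
- exact: continuous_subspaceT.
- split.
  + by move=> t _; have [] := dg t.
  + apply: cvg_at_right_filter; apply: differentiable_continuous.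
    by apply/derivable1_diffP; have [] := dg (- N).
  + apply: cvg_at_left_filter; apply: differentiable_continuous.
    by apply/derivable1_diffP; have [] := dg N.
- by move=> t _; rewrite derive1E; have [_ ->] := dg t.
Qed.

Lemma integral_pderiv_line O phi x j : test_fun O phi -> coord j x = 0 ->
  (\int[lebesgue_measure]_t (pderiv [:: j] phi (x + t *: basis_vec j))%:E = 0)%E.
Proof.
move=> tphi xj; have [M M0 HM] := test_box tphi.
apply: (@integral_derive_compact (fun t => phi (x + t *: basis_vec j)) _ M).
- move=> t; apply: derive_along; apply: smooth_derivable; exact: tphi.1.
- move=> t; apply: (@cvg_comp _ _ _ (fun t => x + t *: basis_vec j) (pderiv [:: j] phi)); last first.
    by apply: smooth_continuous; apply: smooth_pderiv; exact: tphi.1.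
  apply: cvgD; first exact: cvg_cst.
  by apply: cvgZr_tmp; exact: cvg_id.
- move=> t tM; apply: (HM _ j); rewrite coord_line xj add0r.
  by rewrite eqxx mulr1.
Qed.

End TestFunctions.

Section Divergence.
Context {R : realType}.
Implicit Types (phi : R3 R -> R) (j : 'I_3) (O : set (R3 R)).

Lemma mu2_square (N : R) : (mu2 (`[(- N)%R, N] `*` `[(- N)%R, N]) < +oo)%E.
Proof.
have -> : mu2 (`[(- N)%R, N]%classic `*` `[(- N)%R, N]%classic) =
    (@lebesgue_measure R `[(- N)%R, N]%classic * @lebesgue_measure R `[(- N)%R, N]%classic)%E.
  by apply: product_measure1E; exact: measurable_itv.
by rewrite lebesgue_measure_itv /=; case: ifPn => _;
  rewrite ?mule0 ?ltry// -EFinB -EFinM ltry.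
Qed.
(** Fubini's theorem below needs the plane measure as a sigma-finite measure,
    while it is only given as a measure. *)
Lemma mu2_sigma_finite : sigma_finite setT (@mu2 R).
Proof.
exists (fun n => `[(- n%:R)%R, n%:R] `*` `[(- n%:R)%R, n%:R]).
  apply/esym; rewrite -subTset => -[a b] _.
  exists (Num.bound (`|a| + `|b|)) => //.
  have H := archi_boundP (addr_ge0 (normr_ge0 a) (normr_ge0 b)).
  have := normr_ge0 a; have := normr_ge0 b.
  by split; rewrite /= in_itv /= -ler_norml; lra.
move=> n; split; last exact: mu2_square.
by apply: measurableX; exact: measurable_itv.
Qed.

Definition plane_measure : {sigma_finite_measure set (R2 R) -> \bar R} :=
  HB.pack (Measure.sort (@mu2 R)) (Measure.class (@mu2 R))
    (Measure_isSigmaFinite.Build _ _ _ (@mu2 R) mu2_sigma_finite).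

Lemma bounded_support_integrable d (T : measurableType d)
    (mu : {measure set T -> \bar R}) (B : set T) (f : T -> R) M :
  measurable B -> (mu B < +oo)%E -> measurable_fun setT f ->
  (forall x, `|f x| <= M) -> (forall x, ~ B x -> f x = 0) ->
  mu.-integrable setT (EFin \o f).
Proof.
move=> mB Boo mf fM f0.
have -> : EFin \o f = (EFin \o f) \_ B.
  apply/funext => x; rewrite patchE; case: ifPn => // /negP xB /=.
  by rewrite f0// => Bx; apply: xB; rewrite inE.
apply/(integrable_restrict mu) => //; rewrite setTI.
apply: (@bounded_integrable _ _ _ _ _ mB Boo _ M) => //.
exact: measurable_funS mf.
Qed.

Lemma test_integrable O phi : test_fun O phi -> mu3.-integrable setT (EFin \o phi).
Proof.
move=> tphi; have [M M0 HM] := test_bounded tphi.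
have [N N0 HN] := test_box tphi.
apply: (@bounded_support_integrable _ _ _ (closed_box (fun=> - N) (fun=> N)) _ M) => //.
- exact: measurable_closed_box.
- by rewrite mu3_closed_box ?ltry// => i; lra.
- exact: test_measurable tphi.
- move=> x /existsNP[i /negP]; rewrite -ler_norml -ltNge; exact: HN.
Qed.

(** By Fubini, integrate first along the lines of direction j, where the integral
    is that of the derivative of a compactly supported function. *)
Lemma integral_pderiv0 O phi j : test_fun O phi ->
  (\int[mu3]_x (pderiv [:: j] phi x)%:E = 0)%E.
Proof.
move=> tphi; have tD := test_pderiv [:: j] tphi.
have If := test_integrable tD.
have [M M0 HM] := test_bounded tD; have [N N0 HN] := test_box tD.
have mf : measurable_fun setT (pderiv [:: j] phi) by exact: test_measurable tD.
have lineE (x : R3 R) : coord j x = 0 ->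
    (\int[lebesgue_measure]_t (pderiv [:: j] phi (x + t *: basis_vec j))%:E = 0)%E.
  by move=> xj; exact: (integral_pderiv_line tphi xj).
have slice (z : measurableTypeR R) :
    (@lebesgue_measure R \x @lebesgue_measure R)%E.-integrable setT
      (fun p => (pderiv [:: j] phi (p, z))%:E).
  pose B : set (R2 R) := `[- N, N] `*` `[- N, N].
  apply: (@bounded_support_integrable _ _ (@mu2 R) B
      (fun p => pderiv [:: j] phi (p, z)) M) => //.
  - by apply: measurableX; exact: measurable_itv.
  - have E : lebesgue_measure (`[- N, N]%classic : set R) = (N + N)%:E.
      rewrite lebesgue_measure_itv /= lte_fin ifT; last by lra.
      by rewrite -EFinB opprK.
    have -> : mu2 B = (@lebesgue_measure R `[(- N)%R, N]%classic *
        @lebesgue_measure R `[(- N)%R, N]%classic)%E.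
      by apply: product_measure1E; exact: measurable_itv.
    by rewrite E -EFinM ltry.
  - have mp : measurable_fun setT (fun p : R2 R => (p, z)).
      by apply: (@measurable_fun_pair _ _ _ _ _ _ id (cst z)).
    exact: (measurableT_comp mf mp).
  - move=> p Np; have [Ha|Ha] := ltP N `|p.1|; first exact: (HN _ 0).
    have [Hb|Hb] := ltP N `|p.2|; first exact: (HN _ 1).
    by exfalso; apply: Np; split; rewrite /= in_itv /= -ler_norml.
have vecE a b c (t : R) : ((a, b, c) : R3 R) + t *: basis_vec j =
    (a + t * (j == 0%N :> nat)%:R, b + t * (j == 1%N :> nat)%:R,
     c + t * (j == 2%N :> nat)%:R) by [].
pose f (p : R3 R) : \bar R := (pderiv [:: j] phi p)%:E.
have [Hj|Hj|Hj] : [\/ j = 2, j = 1 | j = 0].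
  move: (j); apply/forall_ord3; split; [exact: Or33|exact: Or32|exact: Or31].
- apply: etrans (esym (@integral12_prod_meas1 _ _ _ _ R plane_measure lebesgue_measure f If)) _.
  apply: integral0_eq => -[a b] _.
  apply: etrans _ (lineE (a, b, 0) _); last by rewrite Hj.
  apply: eq_integral => t _; congr (_ %:E); congr (pderiv _ _ _).
  by rewrite vecE Hj /= !mulr0 mulr1 !addr0 add0r.
- apply: etrans (esym (@integral21_prod_meas1 _ _ _ _ R plane_measure lebesgue_measure f If)) _.
  apply: integral0_eq => z _.
  apply: etrans (esym (@integral12_prod_meas1 _ _ _ _ R lebesgue_measure lebesgue_measure
    (fun p => f (p, z)) (slice z))) _.
  apply: integral0_eq => a _.
  apply: etrans _ (lineE (a, 0, z) _); last by rewrite Hj.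
  apply: eq_integral => t _; congr (_ %:E); congr (pderiv _ _ _).
  by rewrite vecE Hj /= !mulr0 mulr1 !addr0 add0r.
- apply: etrans (esym (@integral21_prod_meas1 _ _ _ _ R plane_measure lebesgue_measure f If)) _.
  apply: integral0_eq => z _.
  apply: etrans (esym (@integral21_prod_meas1 _ _ _ _ R lebesgue_measure lebesgue_measure
    (fun p => f (p, z)) (slice z))) _.
  apply: integral0_eq => b _.
  apply: etrans _ (lineE (0, b, z) _); last by rewrite Hj.
  apply: eq_integral => t _; congr (_ %:E); congr (pderiv _ _ _).
  by rewrite vecE Hj /= !mulr0 mulr1 !addr0 add0r.
Qed.

(** Every integration by parts of this development is an instance of this
    vanishing for a suitable product. *)
Lemma Rintegral_pderiv0 O phi j : test_fun O phi ->
  \int[mu3]_(x in O) (pderiv [:: j] phi x) = 0.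
Proof.
move=> tphi; rewrite Rintegral_mkcond /Rintegral.
transitivity (fine (\int[mu3]_x (pderiv [:: j] phi x)%:E)%E); last first.
  by rewrite (integral_pderiv0 j tphi).
congr fine.
apply: eq_integral => x _; rewrite patchE; case: ifPn => // /negP xO.
by rewrite (test_out (test_pderiv [:: j] tphi))// => Ox; apply: xO; rewrite inE.
Qed.

End Divergence.

(** * The du Bois-Reymond lemma *)

Section DuBoisReymond.
Context {R : realType}.
Implicit Types (x : R3 R) (i j : 'I_3) (lo hi : 'I_3 -> R) (O : set (R3 R)).

Definition open_boxes : set (set (R3 R)) :=
  [set A | exists lo hi, A = open_box lo hi].

(** Boxes form a generating pi-system, so that Dynkin's lemma extends the
    vanishing of an integral from boxes to measurable sets. *)
Lemma measurable_open_boxes : @measurable _ (R3 R) = <<s open_boxes >>.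
Proof.
apply/seteqP; split; last first.
  apply: smallest_sub; first exact: sigma_algebra_measurable.
  by move=> _ [lo [hi ->]]; exact: measurable_open_box.
pose T := g_sigma_algebraType open_boxes.
have mopen O : open O -> (measurable : set (set T)) O.
  move=> /open_bigcup_cubes ->; rewrite bigcup_mkcond.
  apply: (@countable_bigcupT_measurable _ T) => // q.
  case: ifPn => // _; apply: sub_sigma_algebra.
  by rewrite open_cube_box; eexists; eexists.
have mcoord i : measurable_fun setT (@coord R i : T -> measurableTypeR R).
  apply: (measurability _ (RGenOpens.measurableE R)) => //.
  move=> _ [_ [a [b ->] <-]]; rewrite setTI; apply: mopen.
  by apply: open_comp => [x _|]; [exact: coord_continuous|exact: interval_open].
have mid : measurable_fun setT (id : T -> R3 R).
  have -> : (id : T -> R3 R) = (fun x => ((coord 0 x, coord 1 x), coord 2 x)).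
    by apply/funext => -[[a b] c].
  apply: measurable_fun_pair; last exact: mcoord.
  by apply: measurable_fun_pair; exact: mcoord.
by move=> A mA; have := mid measurableT A mA; rewrite setTI.
Qed.

Lemma box_bump_cvg lo hi x : open_box lo hi x ->
  box_bump n.+1%:R lo hi x @[n --> \oo] --> (1 : R).
Proof.
move=> xB; apply/cvgrPdist_le => e e0.
(* the bump is at least 1 - 6 / M, and 6 / M <= e *)
pose M := 6 / e + 2; have M2 : 2 <= M by rewrite lerDr divr_ge0// ltW.
have M0 : 0 < M by lra.
have H i : \forall n \near \oo, M + 1 <= n.+1%:R * (hi i - coord i x) /\
    M + 1 <= n.+1%:R * (coord i x - lo i).
  have /andP[lox xhi] := xB i.
  near=> n; split; rewrite -ler_pdivrMr ?subr_gt0//.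
    apply: (@le_trans _ _ n%:R); last by rewrite ler_nat.
    by near: n; exact: nbhs_infty_ger.
  apply: (@le_trans _ _ n%:R); last by rewrite ler_nat.
  by near: n; exact: nbhs_infty_ger.
near=> n.
have Hn i : M + 1 <= n.+1%:R * (hi i - coord i x) /\
    M + 1 <= n.+1%:R * (coord i x - lo i).
  by move: i; apply/forall_ord3; split; near: n; exact: H.
have := @box_bump_ge R n.+1%:R lo hi x M M2 (fun i => (Hn i).1) (fun i => (Hn i).2).
rewrite ger0_norm ?subr_ge0 ?box_bump_le1// => B.
have : 6 / M <= e.
  by rewrite ler_pdivrMr// /M mulrDr mulrCA divff ?gt_eqF// mulr1 lerDl mulr_ge0// ltW.
lra.
Unshelve. all: by end_near. Qed.

Section OneBox.
Variables (O : set (R3 R)) (u : R3 R -> R).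
Hypothesis mO : measurable O.
Hypothesis lu : loc_integrable O u.
Hypothesis u0 : forall phi, test_fun O phi -> \int[mu3]_(x in O) (u x * phi x) = 0.

Lemma integral_test0 phi : test_fun O phi ->
  (\int[mu3]_(x in O) (u x * phi x)%:E = 0)%E.
Proof.
move=> tphi; have := u0 tphi; rewrite /Rintegral => fine0.
have [sphi [K [cK KO K0]]] := tphi.
have mK : measurable K.
  rewrite -[K]setCK; apply: measurableC; apply: open_measurable3.
  by apply: closed_openC; exact: compact_closed3.
have [M M0 HM] := test_bounded tphi.
suff I : mu3.-integrable O (EFin \o (fun x => u x * phi x)).
  by rewrite -[LHS]fineK ?fine0//; exact: integrable_fin_num.
have -> : EFin \o (fun x => u x * phi x) = (EFin \o (fun x => u x * phi x)) \_ K.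
  apply/funext => x; rewrite patchE; case: ifPn => // /negP xK /=.
  by rewrite K0 ?mulr0// => Kx; apply: xK; rewrite inE.
apply/(integrable_restrict mu3) => //; rewrite setIidr//.
have [mu' IK] := lu.
have IuK := IK K cK KO.
apply: (@le_integrable _ _ _ _ _ _ _ (fun x => (M%:E * (u x)%:E)%E)) => //.
- apply/measurable_EFinP; apply: measurable_funM.
    exact: (measurable_funS mO _ mu').
  exact: test_measurable tphi.
- move=> x _ /=; rewrite lee_fin !normrM mulrC ler_wpM2r//.
  exact: le_trans (HM x) (ler_norm _).
- exact: integrableZl.
Qed.

(** The indicator function of a box is a bounded pointwise limit of bumps, which
    are test functions. *)
Lemma integral_subbox0 lo hi a b :
  closed_box lo hi `<=` O -> (forall i, lo i <= a i) -> (forall i, b i <= hi i) ->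
  (\int[mu3]_(x in open_box a b) (u x)%:E = 0)%E.
Proof.
move=> BO loa bhi.
pose Q := closed_box lo hi; have mQ : measurable Q by exact: measurable_closed_box.
have [mu' IK] := lu.
have IQ : mu3.-integrable Q (EFin \o u) by apply: IK => //; exact: compact_closed_box.
have abQ : open_box a b `<=` Q.
  move=> x xab i; have /andP[ax xb] := xab i.
  by rewrite (le_trans (loa i) (ltW ax)) (le_trans (ltW xb) (bhi i)).
pose f_ n x := (u x * box_bump n.+1%:R a b x)%:E.
have tb n : test_fun O (box_bump n.+1%:R a b).
  split; first exact: smooth_box_bump.
  exists Q; split => //; first exact: compact_closed_box.
  by move=> x xQ; apply: box_bump_out => // /abQ.
have f0 n : (\int[mu3]_(x in Q) f_ n x = 0)%E.
  rewrite -[RHS](integral_test0 (tb n)) integral_mkcond [RHS]integral_mkcond.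
  apply: eq_integral => x _; rewrite !patchE.
  case: ifPn => [/[!inE] xQ|/negP xQ]; first by rewrite ifT// inE; exact: BO.
  case: ifPn => // _; rewrite /f_ box_bump_out ?mulr0// => /abQ xQ'.
  by apply: xQ; rewrite inE.
have [] := @dominated_convergence _ _ _ mu3 Q mQ f_
  (fun x => (u x * \1_(open_box a b) x)%:E) (fun x => (`|u x|)%:E).
- move=> n; apply/measurable_EFinP; apply: measurable_funM.
    exact: (measurable_funS mO _ mu').
  exact: test_measurable (tb n).
- apply/measurable_EFinP; apply: measurable_funM.
    exact: (measurable_funS mO _ mu').
  by apply: measurable_indic; exact: measurable_open_box.
- apply: aeW => x _; rewrite /f_.
  have [xab|xab] := pselect (open_box a b x).
    apply: cvg_EFin; first exact: nearW.
    apply: cvgM; first exact: cvg_cst.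
    rewrite indicE mem_set//; exact: box_bump_cvg.
  rewrite indicE memNset// mulr0; apply: cvg_near_cst.
  by apply: nearW => n; rewrite box_bump_out// mulr0.
- exact: integrable_norm.
- apply: aeW => x n _; rewrite /f_ /= lee_fin normrM ler_piMr//.
  by rewrite ger0_norm ?box_bump_ge0 ?box_bump_le1.
move=> _ _ cv.
have -> : (\int[mu3]_(x in open_box a b) (u x)%:E =
   \int[mu3]_(x in Q) (u x * \1_(open_box a b) x)%:E)%E.
  rewrite integral_mkcond [RHS]integral_mkcond; apply: eq_integral => x _.
  rewrite !patchE indicE; case: ifPn => [xab|_]; last by rewrite mulr0 if_same.
  by rewrite mulr1 ifT// inE; apply: abQ; rewrite inE in xab.
have : [sequence (\int[mu3]_(x in Q) f_ n x)%E]_n @ \oo --> (0 : \bar R).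
  by apply: cvg_near_cst; apply: nearW => n /=; exact: f0.
by move=> /(cvg_unique _ cv) -> //.
Qed.

Lemma ae0_box lo hi : closed_box lo hi `<=` O ->
  {ae mu3, forall x, open_box lo hi x -> u x = 0}.
Proof.
move=> BO; pose Q := open_box lo hi.
have mQ : measurable Q by exact: measurable_open_box.
have QB : Q `<=` closed_box lo hi.
  by move=> x xQ i; have /andP[a b] := xQ i; rewrite !ltW.
have [mu' IK] := lu.
have IQ : mu3.-integrable Q (EFin \o u).
  apply: (@integrableS _ _ _ mu3 (closed_box lo hi)) => //.
    exact: measurable_closed_box.
  by apply: IK => //; exact: compact_closed_box.
pose P A := (\int[mu3]_(x in A `&` Q) (u x)%:E = 0)%E.
have PA A : measurable A -> P A.
  move=> mA; apply: (@dynkin_induction _ _ open_boxes P).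
  - exact: measurable_open_boxes.
  - move=> _ _ [a [b ->]] [c [e ->]].
    exists (fun i => Num.max (a i) (c i)), (fun i => Num.min (b i) (e i)).
    apply/seteqP; split => [x [xab xce] i|x xI].
      by rewrite gt_max lt_min; have /andP[-> ->] := xab i; have /andP[-> ->] := xce i.
    by split => i; have := xI i; rewrite gt_max lt_min => /andP[/andP[? ?] /andP[? ?]];
      apply/andP.
  - by rewrite /P setTI; exact: (integral_subbox0 BO).
  - move=> _ [a [b ->]]; rewrite /P.
    have -> : open_box a b `&` Q =
       open_box (fun i => Num.max (a i) (lo i)) (fun i => Num.min (b i) (hi i)).
      apply/seteqP; split => [x [xab xce] i|x xI].
        by rewrite gt_max lt_min; have /andP[-> ->] := xab i; have /andP[-> ->] := xce i.
      by split => i; have := xI i; rewrite gt_max lt_min => /andP[/andP[? ?] /andP[? ?]];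
        apply/andP.
    apply: (integral_subbox0 BO) => i; first by rewrite le_max lexx orbT.
    by rewrite ge_min lexx orbT.
  - move=> S mS PS; rewrite /P.
    have : (\int[mu3]_(x in (S `&` Q) `|` (~` S `&` Q)) (u x)%:E = 0)%E.
      rewrite -setIUl setUv setTI; exact: (integral_subbox0 BO).
    rewrite integral_setU; last 4 first.
    + exact: measurableI.
    + by apply: measurableI => //; exact: measurableC.
    + rewrite -setIUl setUv setTI; exact: measurable_int IQ.
    + by apply/disj_setPS => x [[? _] []].
    by rewrite [X in (X + _)%E](_ : _ = 0%E) ?add0e//; exact: PS.
  - move=> F mF tF PF; rewrite /P setI_bigcupl integral_bigcup.
    + by apply: eseries0 => n _ _; exact: PF.
    + by apply: trivIset_setIr.
    + by move=> k; exact: measurableI.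
    + apply: integrableS IQ => //; first by apply: bigcupT_measurable => k; exact: measurableI.
      by move=> x [k _ []].
  - by rewrite -measurable_open_boxes.
have : ae_eq mu3 Q (EFin \o u) (cst 0%E).
  apply: integral_ae_eq => // E EQ mE.
  by rewrite integral0 -[E in LHS](setIidl EQ); exact: PA.
by apply: filterS => x H /H [].
Qed.

End OneBox.

Lemma du_bois_reymond O u : open O -> loc_integrable O u ->
  (forall phi, test_fun O phi -> \int[mu3]_(x in O) (u x * phi x) = 0) ->
  {ae mu3, forall x, O x -> u x = 0}.
Proof.
move=> oO lu u0; have mO := open_measurable3 oO.
pose D := [set q : rat * rat * rat * rat | cube (ratr q.2) (rat_center q : R3 R) `<=` O].
pose P n x := forall q, unpickle n = Some q -> D q ->
  open_cube (ratr q.2) (rat_center q : R3 R) x -> u x = 0.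
have : {ae mu3, forall x, forall n, P n x}.
  apply: ae_foralln => n; rewrite /P.
  case: (unpickle n) => [q|]; last exact: aeW.
  have [Dq|Dq] := pselect (D q); last by apply: aeW => x _ [<-].
  have := ae0_box mO lu u0 (lo := fun i => coord i (rat_center q : R3 R) - ratr q.2)
    (hi := fun i => coord i (rat_center q : R3 R) + ratr q.2).
  rewrite -cube_box -open_cube_box => /(_ Dq).
  by apply: filterS => x H _ [<-] _; exact: H.
apply: filterS => x Px Ox; rewrite (open_bigcup_cubes oO) in Ox.
have [q qD xq] := Ox.
by apply: (Px (pickle q) q); rewrite ?pickleK.
Qed.

End DuBoisReymond.

(** * The mixed third derivative does not vanish *)

Section Nondegeneracy.
Context {R : realType}.
Implicit Types (x : R3 R) (i j : 'I_3) (s : seq 'I_3) (phi psi f g : R3 R -> R).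

Lemma weak_derivP (O : set (R3 R)) s f g : is_weak_deriv O s f g ->
  is_weak_deriv O s f (weak_deriv O s f).
Proof. by move=> Hg; rewrite /weak_deriv; case: xgetP => [h -> //|/(_ g)]. Qed.

Section Domain.
Variables (O : set (R3 R)) (M : R).
Hypothesis oO : open O.
Hypothesis M0 : 0 < M.
Hypothesis OM : forall x i, O x -> `|coord i x| <= M.

Let mO : measurable O := open_measurable3 oO.

Lemma mu3_lty : (mu3 O < +oo)%E.
Proof.
have mB := measurable_closed_box (fun=> - M) (fun=> M).
apply: (@le_lt_trans _ _ (mu3 (closed_box (fun=> - M) (fun=> M)))).
  apply: le_measure; rewrite ?inE// => x Ox i.
  by rewrite -ler_norml OM.
by rewrite mu3_closed_box ?ltry// => i; move: M0; lra.
Qed.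

Lemma test_sq_integrable phi : test_fun O phi -> sq_integrable mu3 O phi.
Proof.
move=> tphi; have [C C0 HC] := test_bounded tphi.
apply: (bounded_sq_integrable mO mu3_lty (M := C)) => //.
exact: test_measurable tphi.
Qed.

Lemma test_mul_integrable phi psi : test_fun O phi -> test_fun O psi ->
  mu3.-integrable O (EFin \o (phi * psi)).
Proof.
by move=> tphi tpsi; apply: sq_integrableM => //; exact: test_sq_integrable.
Qed.

Lemma test_integrable_on phi : test_fun O phi -> mu3.-integrable O (EFin \o phi).
Proof.
move=> tphi; apply: integrableS (test_integrable tphi) => //.
Qed.

Lemma test_coordM i phi : test_fun O phi -> test_fun O (phi * @coord R i).
Proof. by move=> tphi; apply: test_mul => //; exact: smooth_coord. Qed.

Lemma coord_mul_sq_le i phi : test_fun O phi ->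
  \int[mu3]_(x in O) ((phi x * coord i x) ^+ 2) <=
  M ^+ 2 * \int[mu3]_(x in O) (phi x ^+ 2).
Proof.
move=> tphi; have [mphi Iphi] := test_sq_integrable tphi.
rewrite -RintegralZl//; apply: le_Rintegral => //.
- by have [] := test_sq_integrable (test_coordM i tphi).
- exact: (integrableZl mO (M ^+ 2) Iphi).
- move=> x Ox; rewrite exprMn mulrC ler_wpM2r ?sqr_ge0//.
  by rewrite -real_normK ?num_real// ler_pXn2r ?nnegrE ?(ltW M0)// OM.
Qed.

(** Integrate d_i (x_i phi^2) = phi^2 + 2 x_i phi d_i phi, where |x_i| <= M. *)
Lemma poincare i phi : test_fun O phi ->
  \int[mu3]_(x in O) (phi x ^+ 2) <=
  4 * M ^+ 2 * \int[mu3]_(x in O) (pderiv [:: i] phi x ^+ 2).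
Proof.
move=> tphi; have sphi := tphi.1; have tD := test_pderiv [:: i] tphi.
have tc := test_coordM i tphi.
have E : pderiv [:: i] (phi * (phi * @coord R i)) =
    fun x => phi x ^+ 2 + 2 * ((phi x * coord i x) * pderiv [:: i] phi x).
  rewrite !pderivM ?pderiv_coord//; last 2 first.
  - exact: smooth_coord.
  - by apply: smoothM => //; exact: smooth_coord.
  by apply/funext => x; rewrite !fctE eqxx (mulr1 (phi x)); ring.
have I1 := (test_sq_integrable tphi).2.
have I2 : mu3.-integrable O (EFin \o ((phi * @coord R i) * pderiv [:: i] phi)).
  exact: test_mul_integrable.
have := Rintegral_pderiv0 i (test_mul tphi tc.1).
rewrite E RintegralD//; last exact: (integrableZl mO 2 I2).
rewrite RintegralZl// => H.
have CS := cauchy_schwarz mO (test_sq_integrable tc) (test_sq_integrable tD).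
have Le := coord_mul_sq_le i tphi.
have X0 := sq_integral_ge0 mu3 O (pderiv [:: i] phi).
have Y0 := sq_integral_ge0 mu3 O phi.
move: H CS Le X0 Y0.
set Y := \int[mu3]_(x in O) (phi x ^+ 2).
set X := \int[mu3]_(x in O) (pderiv [:: i] phi x ^+ 2).
set Z := \int[mu3]_(x in O) ((phi x * coord i x) ^+ 2).
set W := \int[mu3]_(x in O) _.
move=> H CS Le X0; rewrite le_eqVlt => /predU1P[<-|Y0].
  by rewrite mulr_ge0// mulr_ge0// sqr_ge0.
rewrite -(ler_pM2l Y0).
have YW : Y = - (2 * W) by lra.
have -> : Y * Y = 4 * W ^+ 2 by rewrite {1 2}YW; ring.
have -> : Y * (4 * M ^+ 2 * X) = 4 * ((M ^+ 2 * Y) * X) by ring.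
rewrite ler_pM2l//; apply: (le_trans CS).
by rewrite ler_wpM2r.
Qed.

(** The difference of the two sides is the integral of the divergence
    d_i (d_i phi d_j (x_j phi)) - 1/2 d_j (x_j (d_i phi)^2). *)
Lemma mixed_identity i j phi : i != j -> test_fun O phi ->
  \int[mu3]_(x in O) (pderiv [:: i; i] phi x * pderiv [:: j] (phi * @coord R j) x)
  = - (2^-1 * \int[mu3]_(x in O) (pderiv [:: i] phi x ^+ 2)).
Proof.
move=> ij tphi; have sphi := tphi.1.
set D := pderiv [:: i] phi; have tD : test_fun O D by exact: test_pderiv.
have sD : smooth D := tD.1.
set psi := phi * @coord R j; have tpsi : test_fun O psi by exact: test_coordM.
have sc := @smooth_coord R.
pose V := D * pderiv [:: j] psi; have tV : test_fun O V.
  by apply: test_mul => //; exact: smooth_pderiv tpsi.1.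
pose U := D * (D * @coord R j); have tU : test_fun O U.
  by apply: test_mul => //; apply: (test_coordM j tD).1.
have E1 : pderiv [:: i; j] psi = fun x => D x + pderiv [:: j; i] phi x * coord j x.
  rewrite (pderivC _ _ tpsi.1) -cat1s pderiv_cat [pderiv [:: i] psi]pderivM//.
  rewrite pderiv_coord (eq_sym j) (negbTE ij).
  have -> : pderiv [:: i] phi * @coord R j + phi * cst (false%:R : R) = D * @coord R j.
    by apply/funext => x; rewrite !fctE mulr0 addr0.
  rewrite pderivM// pderiv_coord eqxx /D -pderiv_cat; apply/funext => x.
  by rewrite !fctE (mulr1 (pderiv [:: i] phi x)) addrC.
have EV : pderiv [:: i] V = fun x => pderiv [:: i; i] phi x * pderiv [:: j] psi x
    + D x * (D x + pderiv [:: j; i] phi x * coord j x).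
  rewrite /V pderivM; [|exact: tD.1|exact: smooth_pderiv tpsi.1].
  rewrite -[pderiv [:: i] (pderiv [:: j] psi)]pderiv_cat E1.
  by rewrite -[pderiv [:: i] D]pderiv_cat.
have EU : pderiv [:: j] U = fun x => D x ^+ 2 + 2 * (D x * (pderiv [:: j; i] phi x * coord j x)).
  rewrite /U pderivM//; last exact: smoothM.
  rewrite pderivM// pderiv_coord eqxx -[pderiv [:: j] D]pderiv_cat -[true%:R]/(1 : R).
  by apply/funext => x; rewrite !fctE; ring.
have IV := Rintegral_pderiv0 i tV; have IU := Rintegral_pderiv0 j tU.
have tDj : test_fun O (pderiv [:: j; i] phi * @coord R j).
  by apply: test_coordM; exact: test_pderiv.
have I1 : mu3.-integrable O (EFin \o (pderiv [:: i; i] phi * pderiv [:: j] psi)).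
  by apply: test_mul_integrable; exact: test_pderiv.
have I2 := (test_sq_integrable tD).2.
have I3 : mu3.-integrable O (EFin \o (D * (pderiv [:: j; i] phi * @coord R j))).
  exact: test_mul_integrable.
have HU : - (2^-1 * \int[mu3]_(x in O) (D x ^+ 2)) =
   - (\int[mu3]_(x in O) (D x ^+ 2) + \int[mu3]_(x in O) (D x * (pderiv [:: j; i] phi x * coord j x))).
  move: IU; rewrite EU RintegralD//; last exact: (integrableZl mO 2 I3).
  by rewrite RintegralZl//; lra.
apply: etrans _ (esym HU).
move: IV; rewrite EV.
have -> : (fun x => pderiv [:: i; i] phi x * pderiv [:: j] psi x
    + D x * (D x + pderiv [:: j; i] phi x * coord j x)) =
  (fun x => pderiv [:: i; i] phi x * pderiv [:: j] psi x
    + (D x ^+ 2 + D x * (pderiv [:: j; i] phi x * coord j x))).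
  by apply/funext => x; rewrite mulrDr expr2.
rewrite RintegralD//; last exact: (integrableD mO I2 I3).
rewrite [X in _ + X = _](RintegralD mO I2 I3) => /eqP.
by rewrite addr_eq0 => /eqP.
Qed.

End Domain.
End Nondegeneracy.

Section SobolevApproximation.
Context {R : realType}.
Implicit Types (x : R3 R) (i j : 'I_3) (s : seq 'I_3) (phi psi f g : R3 R -> R).
Variables (O : set (R3 R)) (M : R).
Hypothesis oO : open O.
Hypothesis M0 : 0 < M.
Hypothesis OM : forall x i, O x -> `|coord i x| <= M.

Let mO : measurable O := open_measurable3 oO.
Let tsq phi (tphi : test_fun O phi) : sq_integrable mu3 O phi :=
  test_sq_integrable oO M0 OM tphi.

Lemma sq_integrable_lty f (e : R) : measurable_fun O f ->
  (\int[mu3]_(x in O) ((f x) ^+ 2)%:E < e%:E)%E ->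
  sq_integrable mu3 O f /\ \int[mu3]_(x in O) (f x ^+ 2) < e.
Proof.
move=> mf fe.
have If : mu3.-integrable O (fun x => (f x ^+ 2)%:E).
  apply/integrableP; split; first exact/measurable_EFinP/measurable_funX.
  under eq_integral do rewrite gee0_abs ?lee_fin ?sqr_ge0//.
  exact: lt_trans fe (ltry _).
split; first by split.
by rewrite -lte_fin /Rintegral fineK//; exact: integrable_fin_num.
Qed.

Variable u : R3 R -> R.
Hypothesis Hu : sobolev0 2 O u.

Let wd s := weak_deriv O s u.

Lemma wdP s : (size s <= 2)%N -> is_weak_deriv O s u (wd s).
Proof.
move=> s2; have [[_ H] _] := Hu; have [g _ gP] := H s s2.
exact: weak_derivP gP.
Qed.

Lemma wd_measurable s : (size s <= 2)%N -> measurable_fun O (wd s).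
Proof. by move=> /wdP[_ []]. Qed.

Lemma approx (e : R) : 0 < e -> exists2 phi, test_fun O phi &
  forall s, (size s <= 2)%N -> sq_integrable mu3 O (wd s - pderiv s phi) /\
    \int[mu3]_(x in O) ((wd s x - pderiv s phi x) ^+ 2) < e.
Proof.
move=> e0; have [_ H] := Hu; have [phi tphi Hphi] := H e e0.
exists phi => // s s2; apply: sq_integrable_lty; last exact: Hphi.
apply: measurable_funB; first exact: wd_measurable.
by apply: test_measurable; exact: (test_pderiv s tphi).
Qed.

Lemma wd_sq_integrable s : (size s <= 2)%N -> sq_integrable mu3 O (wd s).
Proof.
move=> s2; have [phi tphi H] := approx ltr01; have [sq _] := H s s2.
have -> : wd s = (wd s - pderiv s phi) + pderiv s phi.
  by apply/funext => x; rewrite !fctE subrK.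
by apply: sq_integrableD => //; exact/tsq/test_pderiv.
Qed.

Lemma approx_bounded s (e : R) phi : (size s <= 2)%N -> test_fun O phi ->
  \int[mu3]_(x in O) ((wd s x - pderiv s phi x) ^+ 2) < e ->
  \int[mu3]_(x in O) (pderiv s phi x ^+ 2) <=
    2 * e + 2 * \int[mu3]_(x in O) (wd s x ^+ 2).
Proof.
move=> s2 tphi He.
have sw := wd_sq_integrable s2; have sp := tsq (test_pderiv s tphi).
have sd : sq_integrable mu3 O (fun x => -1 * (wd s x - pderiv s phi x)).
  by apply: sq_integrableZ => //; exact: sq_integrableB.
have := sq_integralD_le mO sd sw.
have -> : (fun x => (-1 * (wd s x - pderiv s phi x) + wd s x) ^+ 2) =
    (fun x => pderiv s phi x ^+ 2) by apply/funext => x; congr (_ ^+ 2); ring.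
have -> : (fun x => (-1 * (wd s x - pderiv s phi x)) ^+ 2) =
    (fun x => (wd s x - pderiv s phi x) ^+ 2) by apply/funext => x; ring.
move/le_trans; apply; rewrite lerD2r ler_pM2l//; exact: ltW.
Qed.

Lemma wd_bounded s (e : R) phi : (size s <= 2)%N -> test_fun O phi ->
  \int[mu3]_(x in O) ((wd s x - pderiv s phi x) ^+ 2) < e ->
  \int[mu3]_(x in O) (wd s x ^+ 2) <=
    2 * e + 2 * \int[mu3]_(x in O) (pderiv s phi x ^+ 2).
Proof.
move=> s2 tphi He.
have sw := wd_sq_integrable s2; have sp := tsq (test_pderiv s tphi).
have sd : sq_integrable mu3 O (wd s - pderiv s phi) by exact: sq_integrableB.
have := sq_integralD_le mO sd sp.
have -> : (fun x => ((wd s - pderiv s phi) x + pderiv s phi x) ^+ 2) =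
    (fun x => wd s x ^+ 2) by apply/funext => x; rewrite !fctE subrK.
move/le_trans; apply; rewrite lerD2r ler_pM2l//; exact: ltW.
Qed.

(** With psi = x_j phi in the hypothesis and phi at squared H^2 distance e of u, the
    mixed identity bounds int (d_i phi)^2 by a multiple of sqrt e, and Poincare's
    inequality transfers this to phi, hence to u.  The weak derivative of order 0
    stands for u: the approximation in H^2 is expressed with it. *)
Lemma degenerate_L2_zero i j : i != j ->
  (forall psi, test_fun O psi ->
     \int[mu3]_(x in O) (wd [:: i; i] x * pderiv [:: j] psi x) = 0) ->
  \int[mu3]_(x in O) (wd [::] x ^+ 2) = 0.
Proof.
move=> ij H.
pose A0 := \int[mu3]_(x in O) (wd [::] x ^+ 2).
pose A1 := \int[mu3]_(x in O) (wd [:: j] x ^+ 2).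
have A00 : 0 <= A0 by exact: sq_integral_ge0.
have A10 : 0 <= A1 by exact: sq_integral_ge0.
pose C := 2 * (2 + 2 * A0) + 2 * (M ^+ 2 * (2 + 2 * A1)).
have C0 : 0 <= C.
  have a0 : 0 <= 2 + 2 * A0 by lra.
  have a1 : 0 <= M ^+ 2 * (2 + 2 * A1) by rewrite mulr_ge0 ?sqr_ge0//; lra.
  by rewrite /C; lra.
have key (e : R) : 0 < e -> e <= 1 -> exists Y, [/\ 0 <= Y,
    A0 <= 2 * e + 2 * Y & Y ^+ 2 <= (4 * M ^+ 2) ^+ 2 * (4 * (e * C))].
  move=> e0 e1; have [phi tphi Hphi] := approx e0.
  have [sq2 lt2] := Hphi [:: i; i] isT.
  have [sq1 lt1] := Hphi [:: j] isT.
  have [sq0 lt0] := Hphi [::] isT.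
  pose Y := \int[mu3]_(x in O) (phi x ^+ 2).
  pose X := \int[mu3]_(x in O) (pderiv [:: i] phi x ^+ 2).
  exists Y; split; first exact: sq_integral_ge0.
    exact: wd_bounded lt0.
  have X0 : 0 <= X by exact: sq_integral_ge0.
  have Y0 : 0 <= Y by exact: sq_integral_ge0.
  have YX : Y <= 4 * M ^+ 2 * X by exact: (poincare oO M0 OM).
  suff X2 : X ^+ 2 <= 4 * (e * C).
    apply: (@le_trans _ _ ((4 * M ^+ 2 * X) ^+ 2)).
      by rewrite ler_pXn2r ?nnegrE// mulr_ge0// mulr_ge0// sqr_ge0.
    by rewrite exprMn ler_wpM2l// sqr_ge0.
  pose psi := phi * @coord R j.
  have tpsi : test_fun O psi by exact: test_coordM.
  have tDpsi := test_pderiv [:: j] tpsi.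
  have tD := test_pderiv [:: j] tphi.
  have I := mixed_identity oO M0 OM ij tphi.
  have K0 := H psi tpsi.
  have t2 := test_pderiv [:: i; i] tphi.
  have XE : \int[mu3]_(x in O) ((wd [:: i; i] - pderiv [:: i; i] phi) x * pderiv [:: j] psi x)
     = 2^-1 * X.
    have -> : (fun x => (wd [:: i; i] - pderiv [:: i; i] phi) x * pderiv [:: j] psi x) =
      (fun x => wd [:: i; i] x * pderiv [:: j] psi x - pderiv [:: i; i] phi x * pderiv [:: j] psi x).
      by apply/funext => x; rewrite -mulrBl.
    rewrite RintegralB; [|exact: mO|..].
    - by rewrite K0 I sub0r opprK.
    - by apply: (sq_integrableM mO); [exact: wd_sq_integrable|exact: tsq].
    - by apply: (sq_integrableM mO); exact: tsq.
  have CS := cauchy_schwarz mO sq2 (tsq tDpsi).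
  rewrite XE in CS.
  have EC : \int[mu3]_(x in O) (pderiv [:: j] psi x ^+ 2) <= C.
    have tDc := test_coordM j tD.
    have := sq_integralD_le mO (tsq tphi) (tsq tDc).
    have -> : (fun x => (phi x + (pderiv [:: j] phi * @coord R j) x) ^+ 2) =
        (fun x => pderiv [:: j] psi x ^+ 2).
      rewrite /psi pderivM; [|exact: tphi.1|exact: smooth_coord].
      apply/funext => x; congr (_ ^+ 2); rewrite !fctE pderiv_coord eqxx.
      by rewrite (mulr1 (phi x)) addrC.
    move/le_trans; apply; rewrite /C lerD// ler_pM2l//.
      apply: (le_trans (@approx_bounded [::] e phi isT tphi lt0)).
      by rewrite lerD2r ler_piMr.
    apply: (le_trans (coord_mul_sq_le oO M0 OM j tD)).
    rewrite ler_wpM2l ?sqr_ge0//.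
    apply: (le_trans (@approx_bounded [:: j] e phi isT tphi lt1)).
    by rewrite lerD2r ler_piMr.
  have -> : X ^+ 2 = 4 * (2^-1 * X) ^+ 2 by field.
  rewrite ler_pM2l//; apply: (le_trans CS).
  apply: ler_pM; [exact: sq_integral_ge0|exact: sq_integral_ge0| |exact: EC].
  exact: ltW lt2.
apply/eqP; rewrite eq_le; apply/andP; split; last exact: A00.
rewrite leNgt; apply/negP => A0p; rewrite -/A0 in A0p.
pose D := (4 * M ^+ 2) ^+ 2 * (4 * C).
have D0 : 0 <= D by rewrite /D mulr_ge0 ?sqr_ge0 ?mulr_ge0.
(* small enough to contradict A0 <= 2 e + 2 Y and Y^2 <= e D *)
pose e := Num.min 1 (Num.min (A0 / 8) (A0 ^+ 2 / (16 * (D + 1)))).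
have D1 : 0 < D + 1 by lra.
have A2 : 0 < A0 ^+ 2 by rewrite exprn_gt0.
have e0 : 0 < e by rewrite !lt_min ltr01 !divr_gt0//= mulr_gt0.
have e1 : e <= 1 by rewrite ge_min lexx.
have e2 : e <= A0 / 8 by rewrite !ge_min lexx orbT.
have e3 : e <= A0 ^+ 2 / (16 * (D + 1)) by rewrite !ge_min lexx !orbT.
have [Y [Y0 HA HY]] := key e e0 e1.
have HY2 : Y ^+ 2 <= e * D by move: HY; rewrite /D; lra.
have : e * D <= A0 ^+ 2 / 16.
  apply: (@le_trans _ _ (e * (D + 1))); first by rewrite ler_wpM2l ?(ltW e0)//; lra.
  by move: e3; rewrite ler_pdivlMr ?mulr_gt0// => e3; rewrite ler_pdivlMr//; lra.
have Y3 : 3 / 8 * A0 <= Y by lra.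
have : (3 / 8 * A0) ^+ 2 <= Y ^+ 2 by rewrite ler_pXn2r ?nnegrE// mulr_ge0.
have -> : (3 / 8 * A0) ^+ 2 = 9 / 64 * A0 ^+ 2 by field.
by lra.
Qed.

(** If no psi exists, the weak derivative of order 0 is null in L^2; u itself then
    vanishes by the du Bois-Reymond lemma, as the two are only known to have the
    same integrals against test functions. *)
Lemma nondegenerate i j : i != j -> ~ {ae mu3, forall x, O x -> u x = 0} ->
  exists2 psi, test_fun O psi &
     \int[mu3]_(x in O) (wd [:: i; i] x * pderiv [:: j] psi x) != 0.
Proof.
move=> ij unz; apply/not_exists2P => Hno; apply: unz.
have H psi : test_fun O psi ->
    \int[mu3]_(x in O) (wd [:: i; i] x * pderiv [:: j] psi x) = 0.
  move=> tpsi; apply/eqP; apply/negPn/negP => nz.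
  by have [] := Hno psi.
have Z := degenerate_L2_zero ij H.
have [lu _ w0] := wdP (s := [::]) isT.
apply: (du_bois_reymond oO lu) => phi tphi.
have := w0 phi tphi; rewrite /= mul1r => ->.
have CS := cauchy_schwarz mO (wd_sq_integrable (s := [::]) isT) (tsq tphi).
rewrite Z mul0r in CS.
by apply/eqP; rewrite -sqrf_eq0 eq_le CS sqr_ge0.
Qed.

End SobolevApproximation.

(** * The local polynomial space *)

Section CubicSpace.
Context {R : realType}.
Implicit Types (x : R3 R) (i j k l : 'I_3) (s : seq 'I_3) (f g p : R3 R -> R).

Lemma pderiv_local (A : set (R3 R)) f g s : open A ->
  (forall x, A x -> f x = g x) -> forall x, A x -> pderiv s f x = pderiv s g x.
Proof.
move=> oA fg; elim: s => [|i s IH] x Ax; first exact: fg.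
rewrite -(cat1s i s) !pderiv_cat; apply: near_eq_derive.
have : nbhs x A by exact: open_nbhs_nbhs.
by apply: filterS => y; exact: IH.
Qed.

Lemma smooth_sum (I : Type) (r : seq I) (F : I -> R3 R -> R) :
  (forall a, smooth (F a)) -> smooth (\sum_(a <- r) F a).
Proof.
move=> sF; elim/big_rec: _ => [|a f _ sf]; first exact: (smooth_cst 0).
exact: smoothD.
Qed.

Lemma pderiv_sum (I : Type) (r : seq I) (F : I -> R3 R -> R) s :
  (forall a, smooth (F a)) ->
  pderiv s (\sum_(a <- r) F a) = \sum_(a <- r) pderiv s (F a).
Proof.
move=> sF; elim: r => [|a r IH].
  rewrite !big_nil; elim: s => // j s IHs.
  rewrite -cat1s pderiv_cat IHs; exact: (pderiv_cst 0).
by rewrite !big_cons pderivD ?IH//; exact: smooth_sum.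
Qed.

(** The property of P_T that the lower bound rests on; it is stable under linear
    combinations, so that monomials suffice. *)
Definition pure_affine i f :=
  smooth f /\ exists a b : R, forall x, pderiv [:: i; i] f x = a + b * coord i x.

Lemma pure_affineD i f g : pure_affine i f -> pure_affine i g -> pure_affine i (f + g).
Proof.
move=> [sf [a [b Hf]]] [sg [c [d Hg]]]; split; first exact: smoothD.
by exists (a + c), (b + d) => x; rewrite pderivD// fctE Hf Hg mulrDl addrACA.
Qed.

Lemma pderiv_cstM i (c : R) f : smooth f ->
  pderiv [:: i] (cst c * f) = cst c * pderiv [:: i] f.
Proof.
move=> sf; rewrite pderivM//; last exact: smooth_cst.
by rewrite pderiv_cst; apply/funext => x; rewrite !fctE mul0r add0r.
Qed.

Lemma pure_affineZ i (c : R) f : pure_affine i f -> pure_affine i (cst c * f).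
Proof.
move=> [sf [a [b Hf]]]; have sc := @smooth_cst R c; split; first exact: smoothM.
exists (c * a), (c * b) => x; rewrite -cat1s pderiv_cat pderiv_cstM// pderiv_cstM;
  last exact: smooth_pderiv.
by rewrite -pderiv_cat fctE Hf [LHS](mulrDr c) mulrA.
Qed.

Lemma pure_affine_sum i (I : Type) (r : seq I) (F : I -> R3 R -> R) :
  (forall a, pure_affine i (F a)) -> pure_affine i (\sum_(a <- r) F a).
Proof.
move=> HF; elim/big_rec: _ => [|a f _ Hf]; last exact: pure_affineD.
split; first exact: (smooth_cst 0).
exists 0, 0 => x; rewrite mul0r addr0 -cat1s pderiv_cat.
by rewrite (pderiv_cst 0) (pderiv_cst 0).
Qed.

Lemma pure_affine_cst i (c : R) : pure_affine i (cst c).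
Proof.
split; first exact: smooth_cst.
by exists 0, 0 => x; rewrite mul0r addr0 -cat1s pderiv_cat !pderiv_cst.
Qed.

Lemma pure_affine_coord i k : pure_affine i (@coord R k).
Proof.
split; first exact: smooth_coord.
by exists 0, 0 => x; rewrite mul0r addr0 -cat1s pderiv_cat pderiv_coord pderiv_cst.
Qed.

Let sc := @smooth_coord R.

Lemma pderiv_coordM i k l : pderiv [:: i] (@coord R k * @coord R l) =
  cst (k == i)%:R * @coord R l + cst (l == i)%:R * @coord R k.
Proof.
rewrite pderivM// !pderiv_coord; apply/funext => x; rewrite !fctE.
by congr (_ + _); rewrite mulrC.
Qed.

Lemma pure_affine_coord2 i k l : pure_affine i (@coord R k * @coord R l).
Proof.
split; first exact: smoothM.
exists (2 * ((k == i)%:R * (l == i)%:R)), 0 => x.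
have s1 (c : R) m : smooth (cst c * @coord R m) by apply: smoothM => //; exact: smooth_cst.
rewrite -cat1s pderiv_cat pderiv_coordM pderivD// !pderiv_cstM// !pderiv_coord.
by rewrite !fctE; ring.
Qed.

(** Of the cubic monomials, only the cubes and x_1 x_2 x_3 qualify: the second
    derivative of x_k^2 x_l in the direction k depends on x_l. *)
Lemma pure_affine_coord3 i k l m : (k = l /\ l = m) \/ [/\ k != l, l != m & k != m] ->
  pure_affine i (@coord R k * @coord R l * @coord R m).
Proof.
move=> klm; have s2 a b : smooth (@coord R a * @coord R b) by exact: smoothM.
split; first exact: smoothM.
have E1 : pderiv [:: i] (@coord R k * @coord R l * @coord R m) =
   cst (k == i)%:R * (@coord R l * @coord R m) + cst (l == i)%:R * (@coord R k * @coord R m)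
   + cst (m == i)%:R * (@coord R k * @coord R l).
  rewrite pderivM// pderiv_coordM pderiv_coord; apply/funext => x; rewrite !fctE; ring.
have s3 (c : R) a b : smooth (cst c * (@coord R a * @coord R b)).
  by apply: smoothM => //; exact: smooth_cst.
have E2 x : pderiv [:: i; i] (@coord R k * @coord R l * @coord R m) x =
   2 * ((k == i)%:R * (l == i)%:R * coord m x + (k == i)%:R * (m == i)%:R * coord l x
     + (l == i)%:R * (m == i)%:R * coord k x).
  rewrite -cat1s pderiv_cat E1 pderivD//; last exact: smoothD.
  rewrite pderivD// !pderiv_cstM// !pderiv_coordM !fctE; ring.
have nn a b : a != b -> (a == i)%:R * (b == i)%:R = 0 :> R.
  by case: (a =P i) => [->|_]; rewrite ?mul0r// eq_sym => /negbTE ->; rewrite mulr0.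
case: klm => [[kl lm]|[kl lm km]]; last first.
  exists 0, 0 => x; rewrite E2 !nn//. rewrite !mul0r !addr0; exact: mulr0.
exists 0, (6 * (m == i)%:R) => x; rewrite E2 kl lm.
case: (m =P i) => [->|_]; last by rewrite -[false%:R]/(0 : R) !(mul0r, mulr0, addr0).
by rewrite -[true%:R]/(1 : R) !mul1r mulr1 add0r; ring.
Qed.

Lemma PT_pure_affine i p : PT p -> pure_affine i p.
Proof.
move=> [a [b [q [g [d Hp]]]]].
have -> : p = cst a + \sum_(k < 3) cst (b k) * @coord R k
  + \sum_(k < 3) \sum_(l < 3) cst (q k l) * (@coord R k * @coord R l)
  + \sum_(k < 3) cst (g k) * (@coord R k * @coord R k * @coord R k)
  + cst d * (@coord R 0 * @coord R 1 * @coord R 2).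
  apply/funext => x; rewrite Hp !fctE !fct_sumE; congr (_ + _ + _ + _ + _).
  - apply: eq_bigr => k _. rewrite fct_sumE; apply: eq_bigr => l _; by rewrite !fctE mulrA.
  - by apply: eq_bigr => k _; rewrite !fctE (exprS _ 2) (expr2 (coord k x)) -(mulrA (coord k x)).
  - congr (_ * _); rewrite !big_ord_recr big_ord0 /= mul1r.
    by congr (coord _ _ * coord _ _ * coord _ _); exact/val_inj.
apply: pure_affineD; last by apply: pure_affineZ; apply: pure_affine_coord3; right.
apply: pure_affineD; last first.
  by apply: pure_affine_sum => k; apply: pure_affineZ; apply: pure_affine_coord3; left.
apply: pure_affineD; last first.
  by apply: pure_affine_sum => k; apply: pure_affine_sum => l; apply: pure_affineZ;
    exact: pure_affine_coord2.
apply: pure_affineD; first exact: pure_affine_cst.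
by apply: pure_affine_sum => k; apply: pure_affineZ; exact: pure_affine_coord.
Qed.

(** This holds whether or not the interpolation conditions have a solution: the
    default value is itself in P_T. *)
Lemma Pi_K_PT (h : R) c (v : R3 R -> R) : PT (Pi_K h c v).
Proof.
rewrite /Pi_K; case: xgetP => [p _ []//|_].
exists 0, (fun=> 0), (fun _ _ => 0), (fun=> 0), 0 => x.
have z (F : 'I_3 -> R) : (forall k, F k = 0) -> \sum_(k < 3) F k = 0.
  by move=> F0; rewrite big1.
rewrite !z ?mul0r ?addr0//= => k; rewrite ?mul0r//.
by rewrite z// => l; rewrite !mul0r.
Qed.

End CubicSpace.

(** * Meshes and cut-off functions *)

Section Mesh.
Context {R : realType}.
Implicit Types (x c d : R3 R) (i j : 'I_3) (s : seq 'I_3) (phi psi f g : R3 R -> R).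

Section CellBump.
Variables (k h : R).
Hypothesis k0 : 0 < k.
Hypothesis h0 : 0 < h.

(** The steepness is measured in the scale of the element, so that the plateau
    has the same relative size on all meshes. *)
Definition cell_bump c : R3 R -> R :=
  box_bump (k / h) (fun i => coord i c - h) (fun i => coord i c + h).

Let kh0 : 0 < k / h.
Proof. exact: divr_gt0. Qed.

Lemma smooth_cell_bump c : smooth (cell_bump c).
Proof. exact: smooth_box_bump. Qed.

Lemma cell_bump_ge0 c x : 0 <= cell_bump c x.
Proof. exact: box_bump_ge0. Qed.

Lemma cell_bump_le1 c x : cell_bump c x <= 1.
Proof. exact: box_bump_le1. Qed.

Lemma cell_bump_out c x : ~ open_cube h c x -> cell_bump c x = 0.
Proof. by rewrite open_cube_box; exact: box_bump_out. Qed.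

Lemma pderiv_cell_bump_out j c x : ~ open_cube h c x ->
  pderiv [:: j] (cell_bump c) x = 0.
Proof. by rewrite open_cube_box; exact: pderiv_box_bump_out. Qed.

Lemma pderiv_cell_bump_le j c x : `|pderiv [:: j] (cell_bump c) x| <= 12 * (k / h).
Proof. exact: pderiv_box_bump_le. Qed.

Lemma cell_bump_ge (t M : R) c x : 2 <= M -> 0 <= t -> M + 1 <= k * t ->
  cube ((1 - t) * h) c x -> 1 - 6 / M <= cell_bump c x.
Proof.
move=> M2 t0 Mkt xc.
have E : k / h * (t * h) = k * t by field; rewrite gt_eqF.
have xi i : coord i c - (1 - t) * h <= coord i x <= coord i c + (1 - t) * h.
  by rewrite -ler_distl; exact: xc.
apply: box_bump_ge => // i; have /andP[a b] := xi i;
  apply: (le_trans Mkt); rewrite -E ler_wpM2l ?(ltW kh0)//; lra.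
Qed.

End CellBump.

Variables (O : set (R3 R)) (h : R) (T : seq (R3 R)).
Hypothesis HT : triangulation O h T.

Lemma mesh_size_gt0 : 0 < h. Proof. by have [[]] := HT. Qed.

Lemma mesh_cell_sub c : c \in T -> open_cube h c `<=` O.
Proof. by have [_ _ H _ _] := HT; exact: H. Qed.

(** Elements have disjoint interiors, so that a sum over the mesh of quantities
    supported in the open elements has at most one nonzero term at each point. *)
Lemma mesh_sum_cases x :
  (exists2 c, c \in T /\ open_cube h c x & forall F : R3 R -> R,
     (forall d, d \in T -> ~ open_cube h d x -> F d = 0) ->
     \sum_(d <- T) F d = F c) \/
  ((forall c, c \in T -> ~ open_cube h c x) /\ forall F : R3 R -> R,
     (forall d, d \in T -> ~ open_cube h d x -> F d = 0) ->
     \sum_(d <- T) F d = 0).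
Proof.
have [[_ uT] _ _ disj _] := HT.
have [[c [cT xc]]|no] := pselect (exists c, c \in T /\ open_cube h c x).
  left; exists c => // F F0; rewrite (bigD1_seq c)//= big_seq_cond big1 ?addr0//.
  move=> d /andP[dT /eqP dc]; apply: F0 => // xd.
  have := disj c d cT dT (fun e => dc (esym e)).
  by move=> /seteqP[/(_ x) + _]; apply.
right; have H c : c \in T -> ~ open_cube h c x by move=> cT xc; apply: no; exists c.
split=> // F F0; rewrite big_seq big1// => d dT; apply: F0 => //; exact: H.
Qed.

Variable i : 'I_3.

Lemma broken_derivE v : exists a b : R3 R -> R, forall x,
  broken_deriv h T [:: i; i] (Pi_h h T v) x =
  \sum_(c <- T) \1_(open_cube h c) x * (a c + b c * coord i x).
Proof.
have /choice[a /choice[b Hab]] : forall c : R3 R, exists a, exists b : R, forall x,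
    pderiv [:: i; i] (Pi_K h c v) x = a + b * coord i x.
  by move=> c; have [_ ] := PT_pure_affine i (Pi_K_PT h c v).
exists a, b => x; rewrite /broken_deriv /piecewise; apply: eq_big_seq => c cT.
rewrite indicE; have [|] := boolP (x \in open_cube h c); last by rewrite !mul0r.
rewrite inE => xc; congr (_ * _); rewrite -Hab.
apply: (pderiv_local _ (@open_open_cube R h c)) => // y yc.
rewrite /Pi_h /piecewise.
have [[d [dT yd] ->]|[no _]] := mesh_sum_cases y; last by have := no c cT yc.
- have [_ _ _ disj _] := HT.
  have -> : d = c.
    apply: contrapT => dc; have /seteqP[/(_ y) + _] := disj d c dT cT dc; exact.
  by rewrite indicE mem_set// mul1r.
- by move=> e _ ye; rewrite indicE memNset// mul0r.
Qed.

End Mesh.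

Section CutOff.
Context {R : realType}.
Implicit Types (x c d : R3 R) (i j : 'I_3) (s : seq 'I_3) (phi psi f g : R3 R -> R).
Variables (O : set (R3 R)) (M : R).
Hypothesis oO : open O.
Hypothesis M0 : 0 < M.
Hypothesis OM : forall x i, O x -> `|coord i x| <= M.
Let mO : measurable O := open_measurable3 oO.
Let finO := mu3_lty oO M0 OM.

Variables (h : R) (T : seq (R3 R)).
Hypothesis HT : triangulation O h T.
Let h0 := mesh_size_gt0 HT.

(** An open element lies in Omega, hence in the cube of half-width M around 0. *)
Lemma mesh_size_le c : c \in T -> h <= M.
Proof.
move=> cT; rewrite leNgt; apply/negP => Mh.
pose t := (M + h) / 2; pose v : R3 R := basis_vec 0.
have t0 : 0 < t by rewrite /t; move: h0 M0; lra.
have th : t < h by rewrite /t; lra.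
have Mt : M < t by rewrite /t; lra.
have H (e : R) : `|e| < h -> `|coord 0 c + e| <= M.
  move=> eh; have := @OM (c + e *: v) 0; rewrite coord_line mulr1; apply.
  apply: (mesh_cell_sub HT cT) => i; rewrite coord_line addrAC subrr add0r.
  rewrite normrM (le_lt_trans _ eh)// ler_piMr//.
  by case: eqP => _; rewrite ?normr1 ?normr0.
have := H t; rewrite gtr0_norm// => /(_ th); rewrite ler_norml => /andP[_ H1].
have := H (- t); rewrite normrN gtr0_norm// => /(_ th); rewrite ler_norml => /andP[H2 _].
lra.
Qed.

Variable k : R.
Hypothesis k0 : 0 < k.

Definition cutoff : R3 R -> R := \sum_(c <- T) cell_bump k h c.

Lemma smooth_cutoff : smooth cutoff.
Proof. by apply: smooth_sum => c; exact: smooth_cell_bump. Qed.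

Lemma cutoff_cases x :
  (exists2 c, c \in T /\ open_cube h c x & cutoff x = cell_bump k h c x /\
     forall j, pderiv [:: j] cutoff x = pderiv [:: j] (cell_bump k h c) x) \/
  cutoff x = 0 /\ forall j, pderiv [:: j] cutoff x = 0.
Proof.
have E j : pderiv [:: j] cutoff x = \sum_(c <- T) pderiv [:: j] (cell_bump k h c) x.
  by rewrite /cutoff pderiv_sum ?fct_sumE// => c; exact: smooth_cell_bump.
have out d : d \in T -> ~ open_cube h d x -> cell_bump k h d x = 0.
  by move=> _; exact: cell_bump_out.
have dout j d : d \in T -> ~ open_cube h d x -> pderiv [:: j] (cell_bump k h d) x = 0.
  by move=> _; exact: pderiv_cell_bump_out.
have [[c [cT xc] H]|[_ H]] := mesh_sum_cases HT x; [left; exists c => //|right].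
  split=> [|j]; first by rewrite /cutoff fct_sumE; apply: H.
  by rewrite E; apply: H; exact: dout.
split=> [|j]; first by rewrite /cutoff fct_sumE; apply: H.
by rewrite E; apply: H; exact: dout.
Qed.

Lemma cutoff_ge0 x : 0 <= cutoff x.
Proof.
have [[c _ [-> _]]|[-> _]] := cutoff_cases x => //; exact: cell_bump_ge0.
Qed.

Lemma cutoff_le1 x : cutoff x <= 1.
Proof.
by have [[c _ [-> _]]|[-> _]] := cutoff_cases x => //; exact: cell_bump_le1.
Qed.

Lemma cell_bump_le_cutoff c x : c \in T -> cell_bump k h c x <= cutoff x.
Proof.
move=> cT; have [xc|xc] := pselect (open_cube h c x); last first.
  by rewrite cell_bump_out// cutoff_ge0.
rewrite /cutoff fct_sumE (perm_big _ (perm_to_rem cT)) big_cons lerDl.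
by rewrite sumr_ge0// => d _; exact: cell_bump_ge0.
Qed.

(** The derivative of a bump costs a factor k / h; the bound h <= M absorbs the
    term in which the derivative falls on psi. *)
Lemma pderiv_cutoff_le psi (A B : R) j x : test_fun O psi ->
  (forall y, `|psi y| <= A) -> (forall y, `|pderiv [:: j] psi y| <= B) ->
  `|pderiv [:: j] (psi * cutoff) x| <= (B * M + 12 * k * A) / h.
Proof.
move=> [spsi _] HA HB; rewrite pderivM//; last exact: smooth_cutoff.
have A0 : 0 <= A := le_trans (normr_ge0 _) (HA 0).
have B0 : 0 <= B := le_trans (normr_ge0 _) (HB 0).
rewrite !fctE; have [[c [cT _] [-> ->]]|[-> ->]] := cutoff_cases x; last first.
  rewrite !mulr0 addr0 normr0 divr_ge0 ?(ltW h0)// addr_ge0 ?mulr_ge0//; exact: ltW.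
have hM := mesh_size_le cT.
rewrite (le_trans (ler_normD _ _))// mulrDl lerD//.
  rewrite normrM -mulrA ler_pM//.
  rewrite ger0_norm ?cell_bump_ge0// (le_trans (cell_bump_le1 _ _ _ _))//.
  by rewrite ler_pdivlMr// mul1r.
rewrite normrM mulrAC (mulrC _ A) ler_pM//.
by rewrite -mulrA; exact: pderiv_cell_bump_le.
Qed.

(** The orthogonality at the heart of the proof.  With q_c = a_c + b_c x_i, which
    is constant in the direction j, theta is psi times the sum of the q_c times
    the bump of c, and its derivative integrates to 0. *)
Lemma broken_cutoff_flux (a b : R3 R -> R) i j psi : i != j -> test_fun O psi ->
  exists2 theta, test_fun O theta & forall x,
    (\sum_(c <- T) \1_(open_cube h c) x * (a c + b c * coord i x)) *
      pderiv [:: j] (psi * cutoff) x = pderiv [:: j] theta x.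
Proof.
move=> ij tpsi; have spsi := tpsi.1.
pose q c : R3 R -> R := fun x => b c * coord i x + a c.
have sq c : smooth (q c) by exact: smooth_affine.
pose P := \sum_(c <- T) q c * cell_bump k h c.
have sP c : smooth (q c * cell_bump k h c).
  by apply: smoothM => //; exact: smooth_cell_bump.
have sPP : smooth P by exact: smooth_sum.
exists (psi * P); first exact: test_mul.
move=> x; rewrite !pderivM//; last exact: smooth_cutoff.
have EP : pderiv [:: j] P x = \sum_(c <- T) q c x * pderiv [:: j] (cell_bump k h c) x.
  rewrite /P pderiv_sum// fct_sumE; apply: eq_bigr => c _.
  rewrite pderivM//; last exact: smooth_cell_bump.
  by rewrite pderiv_affine (negbTE ij) !fctE mul0r mul0r add0r.
have ES : pderiv [:: j] cutoff x = \sum_(c <- T) pderiv [:: j] (cell_bump k h c) x.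
  by rewrite /cutoff pderiv_sum ?fct_sumE// => c; exact: smooth_cell_bump.
have EP0 : P x = \sum_(c <- T) q c x * cell_bump k h c x by rewrite /P fct_sumE.
have ES0 : cutoff x = \sum_(c <- T) cell_bump k h c x by rewrite /cutoff fct_sumE.
rewrite !fctE EP ES EP0 ES0.
have out d : d \in T -> ~ open_cube h d x -> cell_bump k h d x = 0.
  by move=> _; exact: cell_bump_out.
have dout d : d \in T -> ~ open_cube h d x -> pderiv [:: j] (cell_bump k h d) x = 0.
  by move=> _; exact: pderiv_cell_bump_out.
have qout d : d \in T -> ~ open_cube h d x -> q d x * cell_bump k h d x = 0.
  by move=> dT xd; rewrite out// mulr0.
have qdout d : d \in T -> ~ open_cube h d x ->
    q d x * pderiv [:: j] (cell_bump k h d) x = 0.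
  by move=> dT xd; rewrite dout// mulr0.
have iout d : d \in T -> ~ open_cube h d x ->
    \1_(open_cube h d) x * (a d + b d * coord i x) = 0 :> R.
  by move=> dT xd; rewrite indicE memNset// mul0r.
have [[c [cT xc] H]|[_ H]] := mesh_sum_cases HT x.
  rewrite (H _ out) (H _ dout) (H _ qout) (H _ qdout) (H _ iout).
  rewrite indicE mem_set// /q mul1r.
  move: (pderiv _ _ _) (pderiv _ _ _) (cell_bump _ _ _ _) => D1 D2 E.
  by ring.
rewrite (H _ out) (H _ dout) (H _ qout) (H _ qdout) (H _ iout).
by rewrite !mulr0 mul0r addr0.
Qed.

End CutOff.

Section Skin.
Context {R : realType}.
Implicit Types (x c d : R3 R) (i j : 'I_3).
Variables (O : set (R3 R)) (M : R).
Hypothesis oO : open O.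
Hypothesis M0 : 0 < M.
Hypothesis OM : forall x i, O x -> `|coord i x| <= M.
Let mO : measurable O := open_measurable3 oO.
Let finO := mu3_lty oO M0 OM.
Variables (h : R) (T : seq (R3 R)).
Hypothesis HT : triangulation O h T.
Let h0 := mesh_size_gt0 HT.

Lemma indic_integrable (A : set (R3 R)) : measurable A ->
  mu3.-integrable O (EFin \o \1_A).
Proof.
move=> mA; apply: (bounded_integrable mO finO (M := 1)).
  exact: measurable_indic.
by move=> x _; rewrite indicE; case: (_ \in _); rewrite ?normr1 ?normr0.
Qed.

Lemma Rintegral_indic_on (A : set (R3 R)) : measurable A ->
  \int[mu3]_(x in O) (\1_A x) = fine (mu3 (A `&` O)).
Proof. by move=> mA; rewrite /Rintegral integral_indic. Qed.

Lemma mu3_cube (r : R) c : 0 <= r -> mu3 (cube r c) = (8 * r ^+ 3)%:E.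
Proof.
move=> r0; rewrite cube_box mu3_closed_box; last by move=> i; lra.
congr (_ %:E); rewrite !big_ord_recr big_ord0 /=; ring.
Qed.

Lemma mu3_open_cube (r : R) c : 0 <= r -> mu3 (open_cube r c) = (8 * r ^+ 3)%:E.
Proof.
move=> r0; rewrite open_cube_box mu3_open_box; last by move=> i; lra.
congr (_ %:E); rewrite !big_ord_recr big_ord0 /=; ring.
Qed.

Lemma integrable_sum_seq (I : Type) (r : seq I) (F : I -> R3 R -> R) :
  (forall a, mu3.-integrable O (EFin \o F a)) ->
  mu3.-integrable O (EFin \o (\sum_(a <- r) F a)) /\
  \int[mu3]_(x in O) ((\sum_(a <- r) F a) x) = \sum_(a <- r) \int[mu3]_(x in O) (F a x).
Proof.
move=> IF; elim: r => [|a r [I1 E1]].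
  rewrite !big_nil; split; first exact: (cst_integrable mO finO 0).
  by rewrite (Rintegral_cst mu3 mO 0) mul0r.
rewrite !big_cons; split; first exact: (integrableD mO (IF a) I1).
by rewrite -E1; exact: (RintegralD mO (IF a) I1).
Qed.

(** Elements are disjoint parts of Omega: this controls their number by h^-3, and
    the sum of the boundary layers by their relative volume. *)
Lemma mesh_volume_le : (size T)%:R * (8 * h ^+ 3) <= fine (mu3 O).
Proof.
have [I1 E1] := @integrable_sum_seq _ T (fun c => \1_(open_cube h c))
  (fun c => indic_integrable (measurable_open_cube h c)).
have EC c : c \in T -> \int[mu3]_(x in O) (\1_(open_cube h c) x) = 8 * h ^+ 3.
  move=> cT; rewrite Rintegral_indic_on; last exact: measurable_open_cube.
  rewrite setIidl; last exact: (mesh_cell_sub HT cT).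
  by rewrite mu3_open_cube// ltW.
have -> : (size T)%:R * (8 * h ^+ 3) = \sum_(c <- T) (8 * h ^+ 3).
  by rewrite big_const_seq count_predT iter_addr addr0 mulr_natl.
rewrite -(eq_big_seq _ EC) -E1 -[leRHS]mul1r -(Rintegral_cst mu3 mO 1).
apply: le_Rintegral => //; first exact: (cst_integrable mO finO 1).
move=> x _; rewrite fct_sumE.
have out d : d \in T -> ~ open_cube h d x -> \1_(open_cube h d) x = 0 :> R.
  by move=> _ xd; rewrite indicE memNset.
have [[c _ H]|[_ H]] := mesh_sum_cases HT x; rewrite (H _ out)//.
Qed.

Variable t : R.
Hypothesis t0 : 0 < t.
Hypothesis t1 : t <= 1.

(** With this steepness a bump is at least 1 - t on the concentric cube of
    relative size 1 - t, as 6 / (6 / t) = t in cell_bump_ge. *)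
Definition steepness := (6 / t + 1) / t.

Lemma steepness_gt0 : 0 < steepness.
Proof. by rewrite divr_gt0// ltr_pwDr// divr_ge0// ltW. Qed.

Let skin c := cube h c `\` cube ((1 - t) * h) c.

Let mskin c : measurable (skin c).
Proof. by apply: measurableD; exact: measurable_cube. Qed.

Lemma skin_integral_le c : \int[mu3]_(x in O) (\1_(skin c) x) <= 3 * t * (8 * h ^+ 3).
Proof.
rewrite Rintegral_indic_on//.
have th0 : 0 <= (1 - t) * h by rewrite mulr_ge0 ?(ltW h0)// subr_ge0.
have sub : cube ((1 - t) * h) c `<=` cube h c.
  move=> x xc i; apply: (le_trans (xc i)); rewrite ler_piMl ?(ltW h0)//.
  by rewrite lerBlDr lerDl ltW.
have Es : mu3 (skin c) = (8 * h ^+ 3 - 8 * ((1 - t) * h) ^+ 3)%:E.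
  have -> : mu3 (skin c) = (mu3 (cube h c) - mu3 (cube ((1 - t) * h) c))%E.
    rewrite /skin measureD; [|exact: measurable_cube|exact: measurable_cube|].
      by rewrite setIidr.
    by apply: (@le_lt_trans _ _ (8 * h ^+ 3)%:E); [rewrite -(mu3_cube c (ltW h0))|exact: ltry].
  by rewrite (mu3_cube c (ltW h0)) (mu3_cube c th0).
have le1 : (mu3 (skin c `&` O) <= mu3 (skin c))%E.
  by apply: le_measure; rewrite ?inE//; exact: measurableI.
have le2 : fine (mu3 (skin c `&` O)) <= 8 * h ^+ 3 - 8 * ((1 - t) * h) ^+ 3.
  rewrite -lee_fin fineK; first by rewrite -Es.
  by rewrite ge0_fin_numE// (le_lt_trans le1)// Es ltry.
apply: (le_trans le2).
have -> : 8 * h ^+ 3 - 8 * ((1 - t) * h) ^+ 3 =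
   8 * h ^+ 3 * (3 * t - t ^+ 2 * (3 - t)) by ring.
rewrite (mulrC (3 * t)) ler_wpM2l//; first by rewrite mulr_ge0// exprn_ge0// ltW.
by rewrite gerBl mulr_ge0 ?sqr_ge0//; move: t1; lra.
Qed.

(** On an element, 1 - S is at most t on the inner cube and at most 1 on the
    boundary layer, whose volume is at most 3 t times that of the element. *)
Lemma cutoff_deficit_le :
  \int[mu3]_(x in O) ((1 - cutoff h T steepness x) ^+ 2) <= 4 * t * fine (mu3 O).
Proof.
pose k := steepness; have k0 : 0 < k := steepness_gt0.
pose F c : R3 R -> R := fun x => t * \1_(cube h c) x + \1_(skin c) x.
have Ic c : mu3.-integrable O (EFin \o (fun x => t * \1_(cube h c) x)).
  exact: (integrableZl mO t (indic_integrable (measurable_cube h c))).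
have IF c : mu3.-integrable O (EFin \o F c).
  exact: (integrableD mO (Ic c) (indic_integrable (mskin c))).
have [IS ES] := integrable_sum_seq T IF.
have sS := smooth_cutoff h T k.
have c0 x := cutoff_ge0 HT k0 x; have c1 x := cutoff_le1 HT k0 x.
have EF c : \int[mu3]_(x in O) (F c x) <= 4 * t * (8 * h ^+ 3).
  rewrite (RintegralD mO (Ic c) (indic_integrable (mskin c))).
  rewrite (RintegralZl t mO (indic_integrable (measurable_cube h c))).
  have := skin_integral_le c.
  have le3 : \int[mu3]_(x in O) (\1_(cube h c) x) <= 8 * h ^+ 3.
    rewrite Rintegral_indic_on; last exact: measurable_cube.
    have mc := measurable_cube h c.
    have le1 : (mu3 (cube h c `&` O) <= mu3 (cube h c))%E.
      by apply: le_measure; rewrite ?inE//; exact: measurableI.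
    rewrite -lee_fin fineK; first by rewrite -(mu3_cube c (ltW h0)).
    by rewrite ge0_fin_numE// (le_lt_trans le1)// (mu3_cube c (ltW h0)) ltry.
  have := ler_wpM2l (ltW t0) le3.
  set a := Rintegral _ _ _; set b := Rintegral _ _ _; move: a b => a b; lra.
apply: (@le_trans _ _ (\int[mu3]_(x in O) ((\sum_(c <- T) F c) x))); last first.
  rewrite ES; apply: (@le_trans _ _ (\sum_(c <- T) (4 * t * (8 * h ^+ 3)))).
    by apply: ler_sum => c _; exact: EF.
  have -> : \sum_(c <- T) (4 * t * (8 * h ^+ 3)) = 4 * t * ((size T)%:R * (8 * h ^+ 3)).
    by rewrite big_const_seq count_predT iter_addr addr0 -[LHS]mulr_natl mulrCA.
  by rewrite ler_wpM2l ?mesh_volume_le// mulr_ge0// ltW.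
apply: le_Rintegral => //.
  apply: (bounded_integrable mO finO (M := 1)).
    apply: measurable_funX; apply: measurable_funB => //.
    by apply: continuous_measurable3; exact: (smooth_continuous sS).
  move=> x _; rewrite normrX expr_le1// ler_norml.
  by have := c0 x; have := c1 x; rewrite -/k; lra.
move=> x Ox; have [_ clO _ _ _] := HT.
have [c cT xc] : exists2 c, c \in T & cube h c x.
  by have : closure O x by [exact: subset_closure]; rewrite clO.
rewrite fct_sumE (perm_big _ (perm_to_rem cT)) big_cons.
apply: (@le_trans _ _ (F c x)); last first.
  rewrite lerDl sumr_ge0// => d _; rewrite /F addr_ge0// ?mulr_ge0 ?(ltW t0)//.
have le1 := cell_bump_le_cutoff HT k0 x cT.
have k1 := c1 x; rewrite /F !indicE (mem_set xc) mulr1 -/k.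
have [xi|xi] := pselect (cube ((1 - t) * h) c x); last first.
  rewrite mem_set// (@le_trans _ _ 1)// ?lerDr ?(ltW t0)//.
  by rewrite expr_le1//; have := c0 x; lra.
rewrite memNset ?addr0; last by case.
have ht : 1 - t <= cell_bump k h c x.
  have -> : t = 6 / (6 / t) by rewrite invf_div mulrCA divff ?mulr1.
  apply: (cell_bump_ge k0 h0 (t := t)) => //.
  - by rewrite ler_pdivlMr//; move: t1; lra.
  - exact: ltW.
  - by rewrite /k /steepness divfK// gt_eqF.
apply: (@le_trans _ _ (t ^+ 2)).
  by rewrite ler_pXn2r ?nnegrE ?(ltW t0)//; have := le1; lra.
by rewrite expr2 ler_piMl ?(ltW t0).
Qed.

End Skin.

(** * The lower bound *)

Section LowerBound.
Context {R : realType}.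
Implicit Types (x c d : R3 R) (i j : 'I_3).

(** The only source of boundedness of the domain: its closure is a finite union
    of cubes. *)
Lemma triangulation_bounded (O : set (R3 R)) (h : R) T : triangulation O h T ->
  exists2 M : R, 0 < M & forall x i, O x -> `|coord i x| <= M.
Proof.
move=> [[h0 _] clO _ _ _].
exists (1 + \sum_(c <- T) (`|c| + h)).
  by rewrite ltr_pwDl// sumr_ge0// => c _; rewrite addr_ge0// ltW.
move=> x i Ox; have [c cT xc] : exists2 c, c \in T & cube h c x.
  by have : closure O x by [exact: subset_closure]; rewrite clO.
rewrite (perm_big _ (perm_to_rem cT)) big_cons.
apply: (@le_trans _ _ (`|c| + h)).
  rewrite -(subrK (coord i c) (coord i x)) addrC (le_trans (ler_normD _ _))//.
  by rewrite lerD ?coord_le_norm.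
rewrite addrCA lerDl addr_ge0// sumr_ge0// => d _; rewrite addr_ge0// ltW//.
Qed.

(** The arithmetic of the last step: E is what the boundary layers take away from
    gam, V the squared norm of the derivative of the test function. *)
Lemma quotient_bound (gam E J C h mu V : R) : 0 < h -> 0 < C -> 0 <= J -> 0 <= mu ->
  E ^+ 2 <= gam ^+ 2 / 4 -> (gam - E) ^+ 2 <= J * V -> V <= (C / h) ^+ 2 * mu ->
  gam ^+ 2 / (4 * (C ^+ 2 * (mu + 1))) * h ^+ 2 <= J.
Proof.
move=> h0 C0 J0 mu0 E2 CS VC.
have mu1 : 0 < mu + 1 by lra.
have g4 : gam ^+ 2 / 4 <= (gam - E) ^+ 2.
  have gE : `|E| <= `|gam| / 2.
    rewrite -(@ler_pXn2r _ 2)// ?nnegrE ?divr_ge0//.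
    rewrite real_normK ?num_real// (le_trans E2)// expr_div_n.
    by rewrite real_normK ?num_real// -natrX.
  have gE2 : `|gam| / 2 <= `|gam - E| by have := lerB_dist gam E; lra.
  have : (`|gam| / 2) ^+ 2 <= `|gam - E| ^+ 2 by rewrite ler_pXn2r ?nnegrE ?divr_ge0.
  by rewrite expr_div_n !real_normK ?num_real// -natrX.
have fin : gam ^+ 2 / 4 <= J * ((C / h) ^+ 2 * (mu + 1)).
  apply: (le_trans g4); apply: (le_trans CS); rewrite ler_wpM2l//.
  by apply: (le_trans VC); rewrite ler_wpM2l ?sqr_ge0// lerDl.
have h2 : 0 < h ^+ 2 by rewrite exprn_gt0.
have -> : gam ^+ 2 / (4 * (C ^+ 2 * (mu + 1))) * h ^+ 2 =
    (gam ^+ 2 / 4) / (C ^+ 2 * (mu + 1) / h ^+ 2).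
  by field; rewrite !gt_eqF.
rewrite ler_pdivrMr; last by rewrite divr_gt0// mulr_gt0// exprn_gt0.
by apply: (le_trans fin); rewrite expr_div_n (mulrAC (C ^+ 2)).
Qed.

Section OneDirection.
Variables (O : set (R3 R)) (M : R) (u : R3 R -> R) (i j : 'I_3).
Hypothesis oO : open O.
Hypothesis M0 : 0 < M.
Hypothesis OM : forall x i, O x -> `|coord i x| <= M.
Hypothesis ij : i != j.
Hypothesis Hu0 : sobolev0 2 O u.
Hypothesis Hu4 : sobolev 4 O u.
Hypothesis unz : ~ {ae mu3, forall x, O x -> u x = 0}.
Let mO : measurable O := open_measurable3 oO.
Let finO := mu3_lty oO M0 OM.

(** The uniformity in the mesh is visible in the order of the choices: psi, the
    layer width t, the steepness k and the bound C are all fixed before h and the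
    mesh are given. *)
Lemma directional_error_ge : exists2 beta : R, 0 < beta &
  forall (h : R) (T : seq (R3 R)), triangulation O h T ->
  ((beta * h ^+ 2)%:E <= \int[mu3]_(x in O)
     ((weak_deriv O [:: i; i] u x
       - broken_deriv h T [:: i; i] (Pi_h h T u) x) ^+ 2)%:E)%E.
Proof.
pose f := weak_deriv O [:: i; i] u.
have sqf : sq_integrable mu3 O f by exact: (wd_sq_integrable oO M0 OM Hu0).
have [G sqG fG] : exists2 G : R3 R -> R, sq_integrable mu3 O G &
    forall phi, test_fun O phi ->
      \int[mu3]_(x in O) (f x * pderiv [:: j] phi x) = - \int[mu3]_(x in O) (G x * phi x).
  have [_ /(_ [:: i; i; j] isT)[G LG [_ _ HG]]] := Hu4.
  exists G => // phi tphi.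
  have [_ _ Hf] := wdP Hu0 (s := [:: i; i]) isT.
  have := Hf _ (test_pderiv [:: j] tphi).
  rewrite -pderiv_cat -[(_ ++ _)%SEQ]/[:: i; i; j] HG//.
  rewrite -[size [:: i; i; j]]/3%N -[size [:: i; i]]/2%N.
  have -> : (-1 : R) ^+ 3 = -1 by ring.
  have -> : (-1 : R) ^+ 2 = 1 by ring.
  by rewrite mul1r mulN1r => <-.
have [psi tpsi nz] := nondegenerate oO M0 OM Hu0 ij unz.
pose gam := \int[mu3]_(x in O) (G x * psi x).
have gam0 : gam != 0 by move: nz; rewrite fG// oppr_eq0.
have [A A0 HA] := test_bounded tpsi.
have [B B0 HB] := test_bounded (test_pderiv [:: j] tpsi).
pose mu := fine (mu3 O).
have mu0 : 0 <= mu by rewrite fine_ge0.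
have sqGpsi : sq_integrable mu3 O (G * psi).
  apply: (sq_integrable_bounded_mul mO sqG (M := A)) => //.
  exact: test_measurable tpsi.
pose Q := \int[mu3]_(x in O) ((G * psi) x ^+ 2).
have Q0 : 0 <= Q by exact: sq_integral_ge0.
have g2 : 0 < gam ^+ 2 by rewrite lt_neqAle sqr_ge0 eq_sym sqrf_eq0 gam0.
(* chosen for (int G psi (1 - S))^2 <= Q * (4 t mu) <= gam^2 / 4 *)
pose t := Num.min 1 (gam ^+ 2 / (16 * (Q * mu + 1))).
have Qmu : 0 <= Q * mu by exact: mulr_ge0.
have t0 : 0 < t by rewrite lt_min ltr01 divr_gt0// mulr_gt0//; lra.
have t1 : t <= 1 by rewrite ge_min lexx.
have t2 : Q * (4 * t * mu) <= gam ^+ 2 / 4.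
  have : t <= gam ^+ 2 / (16 * (Q * mu + 1)) by rewrite ge_min lexx orbT.
  rewrite ler_pdivlMr; last by rewrite mulr_gt0//; lra.
  have := mulr_ge0 (ltW t0) Qmu; lra.
pose k := steepness t; have k0 : 0 < k by exact: steepness_gt0.
pose C := B * M + 12 * k * A.
have C0 : 0 < C by rewrite /C addr_gt0//; apply: mulr_gt0 => //; exact: mulr_gt0.
pose beta := gam ^+ 2 / (4 * (C ^+ 2 * (mu + 1))).
have mu1 : 0 < mu + 1 by lra.
have den0 : 0 < 4 * (C ^+ 2 * (mu + 1)) by rewrite !mulr_gt0// exprn_gt0.
exists beta; first by rewrite divr_gt0.
move=> h T HT; have h0 := mesh_size_gt0 HT.
have [a [b Ebr]] := broken_derivE HT i u.
pose D := fun x => f x - broken_deriv h T [:: i; i] (Pi_h h T u) x.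
have mbr : measurable_fun O (broken_deriv h T [:: i; i] (Pi_h h T u)).
  have -> : broken_deriv h T [:: i; i] (Pi_h h T u) =
     \sum_(c <- T) (fun x => \1_(open_cube h c) x * (a c + b c * coord i x)).
    by apply/funext => x; rewrite Ebr fct_sumE.
  elim/big_rec: _ => [|c g _ mg]; first exact: measurable_cst.
  apply: measurable_funD => //; apply: measurable_funM.
    by apply: measurable_indic; exact: measurable_open_cube.
  apply: measurable_funD => //; apply: measurable_funM => //.
  by apply: continuous_measurable3; exact: coord_continuous.
have mD : measurable_fun O D by apply: measurable_funB => //; exact: sqf.1.
(* an infinite error satisfies the bound *)
have [Jfin|] := boolP ((\int[mu3]_(x in O) (D x ^+ 2)%:E)%E < +oo)%E; last first.
  by rewrite -leNgt leye_eq => /eqP; rewrite /D /f => ->; rewrite leey.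
pose J := \int[mu3]_(x in O) (D x ^+ 2).
have J0 : 0 <= J by exact: sq_integral_ge0.
have JE : (\int[mu3]_(x in O) (D x ^+ 2)%:E)%E = J%:E.
  rewrite /J /Rintegral fineK// ge0_fin_numE// integral_ge0// => x _.
  by rewrite lee_fin sqr_ge0.
have sqD : sq_integrable mu3 O D.
  have [] := @sq_integrable_lty R O oO D (J + 1) mD => //.
  by rewrite JE lte_fin ltrDl.
suff : beta * h ^+ 2 <= J by rewrite -lee_fin -JE.
pose S := cutoff h T k.
have sS : smooth S by exact: smooth_cutoff.
have tPhi : test_fun O (psi * S) by exact: test_mul.
have tdPhi := test_pderiv [:: j] tPhi.
have sqdPhi := test_sq_integrable oO M0 OM tdPhi.
have dPhi_le : \int[mu3]_(x in O) (pderiv [:: j] (psi * S) x ^+ 2) <= (C / h) ^+ 2 * mu.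
  apply: (bounded_sq_integral_le mO finO); first exact: sqdPhi.1.
  by move=> x _; exact: (pderiv_cutoff_le M0 OM HT k0 _ tpsi HA HB).
have [theta ttheta Htheta] := broken_cutoff_flux HT k0 a b ij tpsi.
have DPhi : \int[mu3]_(x in O) (D x * pderiv [:: j] (psi * S) x) =
    - \int[mu3]_(x in O) (G x * (psi * S) x).
  rewrite -(fG _ tPhi).
  have -> : (fun x => D x * pderiv [:: j] (psi * S) x) =
      (fun x => f x * pderiv [:: j] (psi * S) x - pderiv [:: j] theta x).
    by apply/funext => x; rewrite -Htheta /D mulrBl Ebr.
  rewrite (RintegralB mO (sq_integrableM mO sqf sqdPhi)); last first.
    exact: (test_integrable_on oO (test_pderiv [:: j] ttheta)).
  by rewrite (Rintegral_pderiv0 j ttheta) subr0.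
have sq1S : sq_integrable mu3 O (fun x => 1 - S x).
  apply: (bounded_sq_integrable mO finO (M := 1)).
    by apply: measurable_funB => //; apply: continuous_measurable3; exact: smooth_continuous.
  move=> x _; rewrite ger0_norm ?gerBl; first exact: (cutoff_ge0 HT k0).
  by rewrite subr_ge0; exact: (cutoff_le1 HT k0).
have CS1 := cauchy_schwarz mO sqGpsi sq1S.
have def := cutoff_deficit_le oO M0 OM HT t0 t1.
have GS : \int[mu3]_(x in O) (G x * (psi * S) x) =
   gam - \int[mu3]_(x in O) ((G * psi) x * (1 - S x)).
  have IG : mu3.-integrable O (EFin \o (fun x => G x * psi x)).
    exact: (sq_integrableM mO sqG (test_sq_integrable oO M0 OM tpsi)).
  rewrite -(RintegralB mO IG (sq_integrableM mO sqGpsi sq1S)).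
  by apply: eq_Rintegral => x _; rewrite !fctE; ring.
have CS2 := cauchy_schwarz mO sqD sqdPhi.
rewrite DPhi sqrrN GS in CS2.
move: CS1 CS2 def dPhi_le; rewrite -/Q -/J -/S -/mu.
set E := \int[mu3]_(x in O) ((G * psi) x * _).
set W := \int[mu3]_(x in O) _; set V := \int[mu3]_(x in O) _.
move: E W V => E W V CS1 CS2 def dPhi_le.
apply: (quotient_bound h0 C0 J0 mu0 _ CS2 dPhi_le).
exact: le_trans CS1 (le_trans (ler_wpM2l Q0 def) t2).
Qed.

End OneDirection.
End LowerBound.

Theorem lemma3p2 (R : realType) (Omega : set (R3 R)) (lam : R) (u : R3 R -> R) :
  open Omega ->
  eigenpair Omega lam u ->
  sobolev 4 Omega u ->
  exists2 beta : R, 0 < beta &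
    forall (h : R) (T : seq (R3 R)), triangulation Omega h T ->
      ((beta * h ^+ 2)%:E <= J1 Omega h T u)%E.
Proof.
move=> oO [u0 unz _] u4.
(* without a mesh any constant works; with one, Omega is bounded *)
have [[h1 [T1 HT1]]|no] := pselect (exists h T, triangulation Omega h T); last first.
  exists 1 => // h T HT; exfalso; apply: no; by exists h, T.
have [M M0 OM] := triangulation_bounded HT1.
have [beta beta0 H] :=
  @directional_error_ge R Omega M u 0 1 oO M0 OM isT u0 u4 unz.
exists beta => // h T HT; apply: (le_trans (H h T HT)).
rewrite /J1 big_ord_recl leeDl// sume_ge0// => i _.
by apply: integral_ge0 => x _; rewrite lee_fin sqr_ge0.
Qed.
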